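(* Let $\{z^t\}_{t\ge0}$ be a sequence generated by QRTC (as defined in the context). Then there exists a constant $K_2$ such that, for all $t\ge0$, $$K_2\|z^t-z^{t+1}\|_2\ \ge\ \|\Pi_\Lambda(\nabla f(z^t))\|_F .$$ Moreover, any accumulation point $z^*$ of $\{z^t\}$ is a stationary point of the problem $\min_{z\in\Lambda}f(z)$, i.e. $z^*\in\Lambda$ and $\Pi_\Lambda(\nabla f(z^* ))=0$.
   Context: $\mathbb{H}$ is the real quaternion algebra with units $\mathbf{i},\mathbf{j},\mathbf{k}$; for a quaternion matrix, $A^*$ is the conjugate transpose; $\|\cdot\|_F$ is the Frobenius norm of quaternion matrices/tensors (the Euclidean norm for real vectors); $\Re$ is the entrywise real part. Fix a unit pure quaternion $\mu$ ($\mu^2=-1$). $F_{\mu,n}\in\mathbb{H}^{n\times n}$ has entries $\frac1{\sqrt n}\left(\cos\frac{2\pi(p-1)(q-1)}{n}-\mu\sin\frac{2\pi(p-1)(q-1)}{n}\right)$. The QDFT $\hat{\mathcal{X}}$ of $\mathcal{X}\in\mathbb{H}^{n_1\times n_2\times n_3}$ is the tensor with $\hat{\mathcal{X}}(i,j,:)=\sqrt{n_3}\,F_{\mu,n_3}\mathcal{X}(i,j,:)$ (an invertible map), and $\hat{\mathcal{X}}^{(l)}=\hat{\mathcal{X}}(:,:,l)$. Data: $\mathcal{M}\in\mathbb{H}^{n_1\times n_2\times n_3}$ with $\Re(\mathcal{M})=0$; $\Omega\subseteq\{1,\dots,n_1\}\times\{1,\dots,n_2\}\times\{1,\dots,n_3\}$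 with complement $\Omega^c$; $P_\Omega$ (resp. $P_{\Omega^c}$) keeps the entries indexed by $\Omega$ (resp. $\Omega^c$) and sets the others to zero; positive integers $\mathbf{r}=(r_1,\dots,r_{n_3})$; parameters $\lambda,\lambda_1,\lambda_2,\beta>0$. Variables: $\mathcal{C}=\mathcal{C}_{\mathbf i}\mathbf{i}+\mathcal{C}_{\mathbf j}\mathbf{j}+\mathcal{C}_{\mathbf k}\mathbf{k}$ with real tensors $\mathcal{C}_\alpha\in\mathbb{R}^{n_1\times n_2\times n_3}$; $\hat{\mathcal{A}}=(\hat{\mathcal{A}}^{(l)})_{l=1}^{n_3}$ with $\hat{\mathcal{A}}^{(l)}\in\mathbb{H}^{n_1\times r_l}$; $\hat{\mathcal{B}}=(\hat{\mathcal{B}}^{(l)})_{l=1}^{n_3}$ with $\hat{\mathcal{B}}^{(l)}\in\mathbb{H}^{r_l\times n_2}$; $\|\hat{\mathcal{A}}\|_F^2=\sum_l\|\hat{\mathcal{A}}^{(l)}\|_F^2$, likewise for $\hat{\mathcal{B}}$. $\mathcal{A}*_\mu\mathcal{B}\in\mathbb{H}^{n_1\times n_2\times n_3}$ denotes the tensor whose QDFT has $l$-th frontal slice $\hat{\mathcal{A}}^{(l)}\hat{\mathcal{B}}^{(l)}$. All real components of $\mathcal{C},\hat{\mathcal{A}},\hat{\mathcal{B}}$ are collected in a real vector $z\in\mathbb{R}^{3n_1n_2n_3+4\|\mathbf{r}\|_1(n_1+n_2)}$. Let $\mathrm{TV}(\mathcal{C})=\lambda_1\sum_{k=1}^{n_1-1}\|\mathcal{C}(k,:,:)-\mathcal{C}(k+1,:,:)\|_F^2+\lambda_2\sum_{k=1}^{n_2-1}\|\mathcal{C}(:,k,:)-\mathcal{C}(:,k+1,:)\|_F^2$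 and $$f(z)=\tfrac12\|\mathcal{A}*_\mu\mathcal{B}-\mathcal{C}\|_F^2+\tfrac{\lambda}{2n_3}\big(\|\hat{\mathcal{A}}\|_F^2+\|\hat{\mathcal{B}}\|_F^2\big)+\mathrm{TV}(\mathcal{C}).$$ The feasible set is $\Lambda=\{z: P_\Omega(\mathcal{C}-\mathcal{M})=0\}$, and the problem is $\min_{z\in\Lambda}f(z)$. The projected gradient $\Pi_\Lambda(\nabla f(z))$ is the vector obtained from the real gradient $\nabla f(z)$ by replacing each block $\partial f/\partial\mathcal{C}_\alpha$ ($\alpha\in\{\mathbf i,\mathbf j,\mathbf k\}$) by $P_{\Omega^c}(\partial f/\partial\mathcal{C}_\alpha)$ and leaving the blocks for $\hat{\mathcal{A}},\hat{\mathcal{B}}$ unchanged. QRTC sequence: $z^0=(\mathcal{C}^0,\hat{\mathcal{A}}^0,\hat{\mathcal{B}}^0)\in\Lambda$ is arbitrary, and for $t=1,2,\dots$ (no stopping), $z^t=(\mathcal{C}^t,\hat{\mathcal{A}}^t,\hat{\mathcal{B}}^t)$ where: (1) $\mathcal{C}^t$ is the minimizer, over $\mathcal{C}$ with $\Re(\mathcal{C})=0$ and $P_\Omega(\mathcal{C}-\mathcal{M})=0$, of $\frac12\|\mathcal{A}^{t-1}*_\mu\mathcal{B}^{t-1}-\mathcal{C}\|_F^2+\mathrm{TV}(\mathcal{C})+\sum_{\alpha\in\{\mathbf i,\mathbf j,\mathbf k\}}\langle\delta^t_\alpha,\mathcal{C}_\alpha\rangle$, for some error tensor $\delta^t=\delta^t_{\mathbf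 i}\mathbf{i}+\delta^t_{\mathbf j}\mathbf{j}+\delta^t_{\mathbf k}\mathbf{k}$ (so $\Re(\delta^t)=0$) with $P_\Omega(\delta^t)=0$ and $\|P_{\Omega^c}(\delta^t)\|_F\le\frac14\|\mathcal{C}^t-\mathcal{C}^{t-1}\|_F$; (2) for each $l$, $\hat{\mathcal{A}}^{t,(l)}=\big(\hat{\mathcal{C}}^{t,(l)}(\hat{\mathcal{B}}^{t-1,(l)})^*+\beta\hat{\mathcal{A}}^{t-1,(l)}\big)\big(\hat{\mathcal{B}}^{t-1,(l)}(\hat{\mathcal{B}}^{t-1,(l)})^*+(\lambda+\beta)I\big)^{-1}$; (3) for each $l$, $\hat{\mathcal{B}}^{t,(l)}=\big((\hat{\mathcal{A}}^{t,(l)})^*\hat{\mathcal{A}}^{t,(l)}+(\lambda+\beta)I\big)^{-1}\big((\hat{\mathcal{A}}^{t,(l)})^*\hat{\mathcal{C}}^{t,(l)}+\beta\hat{\mathcal{B}}^{t-1,(l)}\big)$. *)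

(* Defs.v *)
From HB Require Import structures.
From mathcomp Require Import all_boot all_order all_algebra.
From mathcomp Require Import ring.
From mathcomp Require Import all_classical all_reals all_analysis.
Set Implicit Arguments.
Unset Strict Implicit.
Unset Printing Implicit Defensive.
Import Order.TTheory GRing.Theory Num.Theory.
Import numFieldNormedType.Exports.
Local Open Scope classical_set_scope.
Local Open Scope ring_scope.

Record quat (R : Type) := Quat { qre : R; qi : R; qj : R; qk : R }.

Definition quat_tuple (R : Type) (q : quat R) : R * R * R * R :=
  (qre q, qi q, qj q, qk q).
Definition tuple_quat (R : Type) (t : R * R * R * R) : quat R :=
  Quat t.1.1.1 t.1.1.2 t.1.2 t.2.
Lemma quat_tupleK (R : Type) : cancel (@quat_tuple R) (@tuple_quat R).
Proof. by case. Qed.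

HB.instance Definition _ (R : eqType) :=
  Equality.copy (quat R) (can_type (@quat_tupleK R)).
HB.instance Definition _ (R : choiceType) :=
  Choice.copy (quat R) (can_type (@quat_tupleK R)).

Section QuatRing.
Context {R : comNzRingType}.
Implicit Types p q : quat R.

Definition qadd p q :=
  Quat (qre p + qre q) (qi p + qi q) (qj p + qj q) (qk p + qk q).
Definition qopp q := Quat (- qre q) (- qi q) (- qj q) (- qk q).
Definition qmul p q := Quat
  (qre p * qre q - qi p * qi q - qj p * qj q - qk p * qk q)
  (qre p * qi q + qi p * qre q + qj p * qk q - qk p * qj q)
  (qre p * qj q - qi p * qk q + qj p * qre q + qk p * qi q)
  (qre p * qk q + qi p * qj q - qj p * qi q + qk p * qre q).
Definition qreal (x : R) := Quat x 0 0 0.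
Definition qconj q := Quat (qre q) (- qi q) (- qj q) (- qk q).

Fact qaddA : associative qadd.
Proof. by move=> [? ? ? ?] [? ? ? ?] [? ? ? ?]; rewrite /qadd /= !addrA. Qed.
Fact qaddC : commutative qadd.
Proof. by move=> [a b c d] [e f g h]; congr Quat; rewrite addrC. Qed.
Fact qadd0 : left_id (qreal 0) qadd.
Proof. by move=> [? ? ? ?]; rewrite /qadd /= !add0r. Qed.
Fact qaddN : left_inverse (qreal 0) qopp qadd.
Proof. by move=> [? ? ? ?]; rewrite /qadd /= !addNr. Qed.

HB.instance Definition _ :=
  GRing.isZmodule.Build (quat R) qaddA qaddC qadd0 qaddN.

Fact qmulA : associative qmul.
Proof.
by move=> [? ? ? ?] [? ? ? ?] [? ? ? ?]; rewrite /qmul /=; congr Quat; ring.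
Qed.
Fact qmul1q : left_id (qreal 1) qmul.
Proof. by move=> [? ? ? ?]; rewrite /qmul /=; congr Quat; ring. Qed.
Fact qmulq1 : right_id (qreal 1) qmul.
Proof. by move=> [? ? ? ?]; rewrite /qmul /=; congr Quat; ring. Qed.
Fact qmulDl : left_distributive qmul qadd.
Proof.
by move=> [? ? ? ?] [? ? ? ?] [? ? ? ?]; rewrite /qmul /qadd /=; congr Quat; ring.
Qed.
Fact qmulDr : right_distributive qmul qadd.
Proof.
by move=> [? ? ? ?] [? ? ? ?] [? ? ? ?]; rewrite /qmul /qadd /=; congr Quat; ring.
Qed.
Fact q1_neq0 : qreal 1 != 0.
Proof. by apply/eqP => -[] /eqP; rewrite oner_eq0. Qed.

HB.instance Definition _ := GRing.Zmodule_isNzRing.Build (quat R)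
  qmulA qmul1q qmulq1 qmulDl qmulDr q1_neq0.

End QuatRing.

Definition qnorm (R : realType) (q : quat R) : R :=
  Num.sqrt (qre q ^+ 2 + qi q ^+ 2 + qj q ^+ 2 + qk q ^+ 2).

Definition unit_pure (R : realType) (mu : quat R) : Prop :=
  qre mu = 0 /\ qnorm mu = 1.

Lemma unit_pure_sqr (R : realType) (mu : quat R) :
  unit_pure mu -> mu * mu = - 1.
Proof.
case: mu => a b c d [/= -> /(congr1 (fun x => x ^+ 2))].
rewrite sqr_sqrtr ?addr_ge0 ?sqr_ge0 //= expr1n => h.
change (qmul (Quat 0 b c d) (Quat 0 b c d) = qopp (qreal 1)).
by rewrite /qmul /qopp /qreal /= -h; congr Quat; ring.
Qed.

Definition ctrmx (R : realType) m n (A : 'M[quat R]_(m, n)) : 'M[quat R]_(n, m) :=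
  map_mx qconj A^T.

Definition mxfro (R : realType) m n (A : 'M[quat R]_(m, n)) : R :=
  Num.sqrt (\sum_i \sum_j qnorm (A i j) ^+ 2).

(* [invmx] needs commutative coefficients; as for [invmx], the value on a
   non-invertible matrix is the matrix itself. *)
Definition qinvmx (R : realType) n (A : 'M[quat R]_n) : 'M[quat R]_n :=
  xget A [set B | A *m B = 1%:M /\ B *m A = 1%:M].

(* Third-order tensors are stored by frontal slices: X(i,j,l) is [X l i j] and
   X(:,:,l) is [X l]. *)
Notation tensor T n1 n2 n3 := {ffun 'I_n3 -> 'M[T]_(n1, n2)}.

Definition tmap (S T : Type) (g : S -> T) n1 n2 n3 (X : tensor S n1 n2 n3) :
    tensor T n1 n2 n3 :=
  [ffun l => map_mx g (X l)].

Definition tube (T : Type) n1 n2 n3 (X : tensor T n1 n2 n3) i j : 'cV[T]_n3 :=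
  \col_l X l i j.

Definition hslice (T : Type) n1 n2 n3 (X : tensor T n1 n2 n3) k : 'M[T]_(n2, n3) :=
  \matrix_(j, l) X l k j.

Definition lslice (T : Type) n1 n2 n3 (X : tensor T n1 n2 n3) k : 'M[T]_(n1, n3) :=
  \matrix_(i, l) X l i k.

Definition tfro (R : realType) n1 n2 n3 (X : tensor (quat R) n1 n2 n3) : R :=
  Num.sqrt (\sum_l \sum_i \sum_j qnorm (X l i j) ^+ 2).

Definition tinner (R : realType) n1 n2 n3 (X Y : tensor R n1 n2 n3) : R :=
  \sum_l \sum_i \sum_j X l i j * Y l i j.

Definition tproj (T : nmodType) n1 n2 n3 (Om : {set 'I_n1 * 'I_n2 * 'I_n3})
    (X : tensor T n1 n2 n3) : tensor T n1 n2 n3 :=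
  [ffun l => \matrix_(i, j) if (i, j, l) \in Om then X l i j else 0].

Definition qdftmx (R : realType) (mu : quat R) n : 'M[quat R]_n :=
  \matrix_(p, q)
    (qreal (Num.sqrt n%:R)^-1 *
     (qreal (cos (2 * pi * p%:R * q%:R / n%:R))
      - mu * qreal (sin (2 * pi * p%:R * q%:R / n%:R)))).

Definition qdft (R : realType) (mu : quat R) n1 n2 n3
    (X : tensor (quat R) n1 n2 n3) : tensor (quat R) n1 n2 n3 :=
  [ffun l => \matrix_(i, j)
    (qreal (Num.sqrt n3%:R) *: (qdftmx mu n3 *m tube X i j)) l 0].

(* The tensor whose QDFT has frontal slices A^(l) B^(l); the arguments are the
   factors in the QDFT domain. *)
Definition qtprod (R : realType) (mu : quat R) n1 n2 n3 (r : 'I_n3 -> nat)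
    (A : forall l, 'M[quat R]_(n1, r l)) (B : forall l, 'M[quat R]_(r l, n2)) :
    tensor (quat R) n1 n2 n3 :=
  xget 0 [set X | qdft mu X = [ffun l => A l *m B l]].

Definition TV (R : realType) (lam1 lam2 : R) n1 n2 n3
    (C : tensor (quat R) n1 n2 n3) : R :=
  lam1 * (\sum_(k < n1) \sum_(k' < n1 | k' == k.+1 :> nat)
            mxfro (hslice C k - hslice C k') ^+ 2)
  + lam2 * (\sum_(k < n2) \sum_(k' < n2 | k' == k.+1 :> nat)
            mxfro (lslice C k - lslice C k') ^+ 2).

(* Index of the real components: imaginary unit and position for C; slice,
   quaternion component and position for the two families of factors. *)
Definition zidx n1 n2 n3 (r : 'I_n3 -> nat) : finType :=
  ('I_3 * ('I_n1 * 'I_n2 * 'I_n3)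
   + {l : 'I_n3 & 'I_4 * ('I_n1 * 'I_(r l))}
   + {l : 'I_n3 & 'I_4 * ('I_(r l) * 'I_n2)})%type.

Lemma card_zidx n1 n2 n3 (r : 'I_n3 -> nat) :
  #|zidx n1 n2 r| = (3 * n1 * n2 * n3 + 4 * (\sum_l r l) * (n1 + n2))%N.
Proof.
rewrite !card_sum !card_tagged !card_prod !card_ord !sumnE !big_map -!enumT.
rewrite !big_enum /=.
under eq_bigr do rewrite !card_prod !card_ord mulnA mulnC.
under [X in (_ + X)%N = _]eq_bigr do rewrite !card_prod !card_ord mulnCA.
by rewrite -!big_distrl /=; ring.
Qed.

Notation zvec R n1 n2 r := 'rV[R]_#|zidx n1 n2 r|.

Section Components.
Context {R : realType} {n1 n2 n3 : nat} {r : 'I_n3 -> nat}.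
Implicit Types z : zvec R n1 n2 r.

Definition zcoord z (x : zidx n1 n2 r) : R := z 0 (enum_rank x).

(* The real tensors C_i, C_j, C_k for a = 0, 1, 2. *)
Definition zCcomp (a : 'I_3) z : tensor R n1 n2 n3 :=
  [ffun l => \matrix_(i, j) zcoord z (inl (inl (a, (i, j, l))))].

Definition zC z : tensor (quat R) n1 n2 n3 :=
  [ffun l => \matrix_(i, j) Quat 0 (zCcomp (inord 0) z l i j)
     (zCcomp (inord 1) z l i j) (zCcomp (inord 2) z l i j)].

Definition zA z (l : 'I_n3) : 'M[quat R]_(n1, r l) :=
  \matrix_(i, s)
    let c a := zcoord z
      (inl (inr (Tagged (fun l => 'I_4 * ('I_n1 * 'I_(r l)))%type (inord a, (i, s))))) in
    Quat (c 0%N) (c 1%N) (c 2%N) (c 3%N).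

Definition zB z (l : 'I_n3) : 'M[quat R]_(r l, n2) :=
  \matrix_(s, j)
    let c a := zcoord z
      (inr (Tagged (fun l => 'I_4 * ('I_(r l) * 'I_n2))%type (inord a, (s, j)))) in
    Quat (c 0%N) (c 1%N) (c 2%N) (c 3%N).

End Components.

Definition l2norm (R : realType) n (v : 'rV[R]_n) : R :=
  Num.sqrt (\sum_k v 0 k ^+ 2).

Definition gradient (R : realType) n (g : 'rV[R]_n -> R) (v : 'rV[R]_n) : 'rV[R]_n :=
  \row_k 'D_(delta_mx 0 k) g v.

Section Problem.
Context {R : realType} {n1 n2 n3 : nat} (r : 'I_n3 -> nat).
Variables (mu : quat R) (M : tensor (quat R) n1 n2 n3).
Variables (Om : {set 'I_n1 * 'I_n2 * 'I_n3}) (lam lam1 lam2 beta : R).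

Definition objective (z : zvec R n1 n2 r) : R :=
  2^-1 * tfro (qtprod mu (zA z) (zB z) - zC z) ^+ 2
  + lam / (2 * n3%:R) * (\sum_l mxfro (zA z l) ^+ 2 + \sum_l mxfro (zB z l) ^+ 2)
  + TV lam1 lam2 (zC z).

Definition feasible : set (zvec R n1 n2 r) := [set z | tproj Om (zC z - M) = 0].

Definition proj_grad (g : zvec R n1 n2 r) : zvec R n1 n2 r :=
  \row_k match enum_val k with
         | inl (inl (a, (i, j, l))) => tproj (~: Om) (zCcomp a g) l i j
         | _ => g 0 k
         end.

Definition stationary (z : zvec R n1 n2 r) : Prop :=
  feasible z /\ proj_grad (gradient objective z) = 0.

Definition minimizer (T : Type) (S : set T) (g : T -> R) (x : T) : Prop :=
  S x /\ forall y, S y -> g x <= g y.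

Definition C_constraint : set (tensor (quat R) n1 n2 n3) :=
  [set C | tmap (@qre R) C = 0 /\ tproj Om (C - M) = 0].

Definition C_objective (z : zvec R n1 n2 r) (delta C : tensor (quat R) n1 n2 n3) : R :=
  2^-1 * tfro (qtprod mu (zA z) (zB z) - C) ^+ 2 + TV lam1 lam2 C
  + (tinner (tmap (@qi R) delta) (tmap (@qi R) C)
     + tinner (tmap (@qj R) delta) (tmap (@qj R) C)
     + tinner (tmap (@qk R) delta) (tmap (@qk R) C)).

Definition C_step (z z' : zvec R n1 n2 r) : Prop :=
  exists delta : tensor (quat R) n1 n2 n3,
    [/\ tmap (@qre R) delta = 0, tproj Om delta = 0,
        tfro (tproj (~: Om) delta) <= 4^-1 * tfro (zC z' - zC z)
      & minimizer C_constraint (C_objective z delta) (zC z')].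

Definition A_step (z z' : zvec R n1 n2 r) : Prop :=
  forall l, zA z' l =
    (qdft mu (zC z') l *m ctrmx (zB z l) + qreal beta *: zA z l)
    *m qinvmx (zB z l *m ctrmx (zB z l) + (qreal (lam + beta))%:M).

Definition B_step (z z' : zvec R n1 n2 r) : Prop :=
  forall l, zB z' l =
    qinvmx (ctrmx (zA z' l) *m zA z' l + (qreal (lam + beta))%:M)
    *m (ctrmx (zA z' l) *m qdft mu (zC z') l + qreal beta *: zB z l).

Definition QRTC_sequence (z : nat -> zvec R n1 n2 r) : Prop :=
  feasible (z 0%N) /\
  forall t, [/\ C_step (z t) (z t.+1), A_step (z t) (z t.+1)
              & B_step (z t) (z t.+1)].

End Problem.

(* Main.v *)
Require Import Defs.
From HB Require Import structures.
From mathcomp Require Import all_boot all_order all_algebra.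
From mathcomp Require Import ring lra.
From mathcomp Require Import all_classical all_reals all_analysis.
Set Implicit Arguments.
Unset Strict Implicit.
Unset Printing Implicit Defensive.
Import Order.TTheory GRing.Theory Num.Theory.
Import numFieldNormedType.Exports.
Local Open Scope classical_set_scope.
Local Open Scope ring_scope.

(** Each update of the algorithm solves one block of the optimality system of
    [f = objective], so the partial derivatives of [f] in that block are small
    at the point reached right after the update.  With [z, z'] consecutive
    iterates they equal the entries of the error tensor up to sign for the [C]
    block ([C_step_line]), and the entries of [beta / n3 * (z - z')] for the two
    factor blocks ([A_step_grad], [B_step_grad]).  Two consequences give the
    theorem.

    Decrease.  On each block [f] is a convex quadratic function, so the first
    order condition after the update bounds the decrease from below by a multiple
    of the squared displacement of the block ([C_decrease], [A_decrease],
    [B_decrease]).  Since [f] is nonnegative, consecutive iterates get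
    arbitrarily close, and since [f] is coercive ([objective_coercive]) the
    sequence is bounded.

    Error bound.  The two intermediate points of an iteration and its end point
    take each real coordinate from [z] or from [z'], hence are no farther from
    [z] than [z'] is.  The objective is a polynomial in the real coordinates, so
    its partial derivatives are polynomials too, and are Lipschitz on the bounded
    set that contains the sequence.  Therefore each partial derivative that the
    projection keeps is bounded at [z] by a multiple of the distance of [z] and
    [z'].  By continuity these partial derivatives vanish at every accumulation
    point.  [descent_criterion] is this argument for an arbitrary polynomial.

    The Fourier transform enters only through its unitarity up to the factor
    [n3], which makes the first term of [f] a sum over frontal slices of the
    polynomials [|A B - C|^2 / (2 n3)] in the transformed domain
    ([tfro_qtprod]).  The matrices that the factor updates invert are
    [X X^* + c I] with [c > 0], which are injective, and injective quaternion
    matrices are invertible by a dimension count over the reals ([qinvmxP]). *)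

(** * The real inner product of quaternions and quaternion matrices *)

Section QuatDot.
Context {R : comNzRingType}.
Implicit Types p q s : quat R.

Lemma qre_add p q : qre (p + q) = qre p + qre q. Proof. by []. Qed.
Lemma qi_add p q : qi (p + q) = qi p + qi q. Proof. by []. Qed.
Lemma qj_add p q : qj (p + q) = qj p + qj q. Proof. by []. Qed.
Lemma qk_add p q : qk (p + q) = qk p + qk q. Proof. by []. Qed.
Lemma qre_opp p : qre (- p) = - qre p. Proof. by []. Qed.
Lemma qi_opp p : qi (- p) = - qi p. Proof. by []. Qed.
Lemma qj_opp p : qj (- p) = - qj p. Proof. by []. Qed.
Lemma qk_opp p : qk (- p) = - qk p. Proof. by []. Qed.
Lemma qmulE p q : p * q = qmul p q. Proof. by []. Qed.
Lemma qzeroE : 0 = qreal 0 :> quat R. Proof. by []. Qed.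
Lemma qoneE : 1 = qreal 1 :> quat R. Proof. by []. Qed.

Definition qcompE := (qre_add, qi_add, qj_add, qk_add,
  qre_opp, qi_opp, qj_opp, qk_opp, qmulE, qzeroE, qoneE).

Lemma quat_eq p q : qre p = qre q -> qi p = qi q -> qj p = qj q ->
  qk p = qk q -> p = q.
Proof. by case: p q => [a b c d] [a' b' c' d'] /= -> -> -> ->. Qed.

Definition qdot p q := qre p * qre q + qi p * qi q + qj p * qj q + qk p * qk q.

Lemma qdotC p q : qdot p q = qdot q p.
Proof. by rewrite /qdot; ring. Qed.

Lemma qdotDl p q s : qdot (p + q) s = qdot p s + qdot q s.
Proof. by rewrite /qdot !qcompE; ring. Qed.

Lemma qdot0l q : qdot 0 q = 0.
Proof. by rewrite /qdot !qcompE /=; ring. Qed.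

Lemma qdotZl (h : R) p q : qdot (qreal h * p) q = h * qdot p q.
Proof. by rewrite /qdot !qcompE /=; ring. Qed.

(** Right multiplication by [s] has right multiplication by its conjugate as its
    adjoint, although the product does not commute, because [qdot p q] is the
    real part of [qconj p * q] and real parts are cyclic. *)
Lemma qdot_adjr p q s : qdot p (q * s) = qdot (p * qconj s) q.
Proof. by rewrite /qdot !qcompE /=; ring. Qed.

Lemma qdot_adjl p q s : qdot p (q * s) = qdot (qconj q * p) s.
Proof. by rewrite /qdot !qcompE /=; ring. Qed.

(** Multiplicativity of the norm; it is what rules out zero divisors below. *)
Lemma qdotMM p q : qdot (p * q) (p * q) = qdot p p * qdot q q.
Proof. by rewrite /qdot !qcompE /=; ring. Qed.

Lemma qrealC (h : R) p : qreal h * p = p * qreal h.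
Proof. by apply: quat_eq; rewrite !qcompE /=; ring. Qed.

Lemma qrealD (a b : R) : qreal (a + b) = qreal a + qreal b.
Proof. by apply: quat_eq; rewrite !qcompE /=; ring. Qed.

Lemma qrealM (a b : R) : qreal (a * b) = qreal a * qreal b.
Proof. by apply: quat_eq; rewrite !qcompE /=; ring. Qed.

Lemma qconjK : involutive (@qconj R).
Proof. by case=> a b c d; rewrite /qconj /= !opprK. Qed.

End QuatDot.

Section MatrixDot.
Context {R : realType}.

Lemma qdot_ge0 (p : quat R) : 0 <= qdot p p.
Proof. by rewrite /qdot -!expr2 !addr_ge0 ?sqr_ge0. Qed.

Lemma qdot_eq0 (p : quat R) : qdot p p = 0 -> p = 0.
Proof.
rewrite /qdot -!expr2 => /eqP.
rewrite !paddr_eq0 ?addr_ge0 ?sqr_ge0 // !sqrf_eq0.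
by case/andP=> /andP[/andP[/eqP a /eqP b] /eqP c] /eqP d; apply: quat_eq.
Qed.

Lemma qnorm_sqr (p : quat R) : qnorm p ^+ 2 = qdot p p.
Proof. by rewrite sqr_sqrtr ?addr_ge0 ?sqr_ge0 // /qdot !expr2. Qed.

Definition mxdot m n (X Y : 'M[quat R]_(m, n)) : R :=
  \sum_i \sum_j qdot (X i j) (Y i j).

Lemma mxdotC m n (X Y : 'M[quat R]_(m, n)) : mxdot X Y = mxdot Y X.
Proof. by apply: eq_bigr => i _; apply: eq_bigr => j _; rewrite qdotC. Qed.

Lemma mxdotDl m n (X Y Z : 'M[quat R]_(m, n)) :
  mxdot (X + Y) Z = mxdot X Z + mxdot Y Z.
Proof.
rewrite /mxdot -big_split; apply: eq_bigr => i _ /=; rewrite -big_split.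
by apply: eq_bigr => j _ /=; rewrite mxE qdotDl.
Qed.

Lemma mxdotDr m n (X Y Z : 'M[quat R]_(m, n)) :
  mxdot Z (X + Y) = mxdot Z X + mxdot Z Y.
Proof. by rewrite !(mxdotC Z) mxdotDl. Qed.

Lemma mxdotZl m n h (X Y : 'M[quat R]_(m, n)) :
  mxdot (qreal h *: X) Y = h * mxdot X Y.
Proof.
rewrite /mxdot mulr_sumr; apply: eq_bigr => i _; rewrite mulr_sumr.
by apply: eq_bigr => j _; rewrite mxE qdotZl.
Qed.

Lemma mxdotZr m n h (X Y : 'M[quat R]_(m, n)) :
  mxdot X (qreal h *: Y) = h * mxdot X Y.
Proof. by rewrite mxdotC mxdotZl mxdotC. Qed.

Lemma mxdot0r m n (X : 'M[quat R]_(m, n)) : mxdot X 0 = 0.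
Proof.
by rewrite /mxdot big1 // => i _; rewrite big1 // => j _; rewrite mxE qdotC qdot0l.
Qed.

Lemma qdot_sumr I (s : seq I) (F : I -> quat R) p :
  qdot p (\sum_(i <- s) F i) = \sum_(i <- s) qdot p (F i).
Proof.
rewrite qdotC (big_morph (fun x => qdot x p) (fun x y => qdotDl x y p) (qdot0l p)).
by apply: eq_bigr => i _; rewrite qdotC.
Qed.

Lemma mxdot_adjr m n p (X : 'M[quat R]_(m, p)) (E : 'M[quat R]_(m, n)) (B : 'M[quat R]_(n, p)) :
  mxdot X (E *m B) = mxdot (X *m ctrmx B) E.
Proof.
apply: eq_bigr => i _.
under eq_bigr do rewrite mxE qdot_sumr.
rewrite exchange_big; apply: eq_bigr => k _ /=.
rewrite mxE [RHS]qdotC qdot_sumr; apply: eq_bigr => j _.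
by rewrite !mxE qdot_adjr qdotC.
Qed.

Lemma mxdot_adjl m n p (X : 'M[quat R]_(m, p)) (A : 'M[quat R]_(m, n)) (E : 'M[quat R]_(n, p)) :
  mxdot X (A *m E) = mxdot (ctrmx A *m X) E.
Proof.
rewrite /mxdot exchange_big [RHS]exchange_big; apply: eq_bigr => j _ /=.
under eq_bigr do rewrite mxE qdot_sumr.
rewrite exchange_big; apply: eq_bigr => k _ /=.
rewrite mxE [RHS]qdotC qdot_sumr; apply: eq_bigr => i _.
by rewrite !mxE qdot_adjl qdotC.
Qed.

Lemma mxdot_ge0 m n (X : 'M[quat R]_(m, n)) : 0 <= mxdot X X.
Proof. by apply: sumr_ge0 => i _; apply: sumr_ge0 => j _; apply: qdot_ge0. Qed.

Lemma mxdot_eq0 m n (X : 'M[quat R]_(m, n)) : mxdot X X = 0 -> X = 0.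
Proof.
move/psumr_eq0P => h; apply/matrixP => i j; rewrite mxE; apply: qdot_eq0.
have /psumr_eq0P := h (fun i _ => sumr_ge0 _ (fun j _ => qdot_ge0 (X i j))) i isT.
by apply=> // k _; apply: qdot_ge0.
Qed.

Lemma mxfro_sqr m n (X : 'M[quat R]_(m, n)) : mxfro X ^+ 2 = mxdot X X.
Proof.
have e : \sum_i \sum_j qnorm (X i j) ^+ 2 = mxdot X X.
  by apply: eq_bigr => i _; apply: eq_bigr => j _; rewrite qnorm_sqr.
by rewrite /mxfro e sqr_sqrtr // mxdot_ge0.
Qed.

Lemma mxdot_line m n h (X Y : 'M[quat R]_(m, n)) :
  mxdot (X + qreal h *: Y) (X + qreal h *: Y)
  = mxdot X X + h * (2 * mxdot X Y) + h ^+ 2 * mxdot Y Y.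
Proof.
rewrite mxdotDl !mxdotDr !mxdotZl !mxdotZr (mxdotC Y X).
by ring.
Qed.

Lemma ctrmxK m n : cancel (@ctrmx R m n) (@ctrmx R n m).
Proof. by move=> X; apply/matrixP => i j; rewrite !mxE qconjK. Qed.

Lemma mulmx_qreal m n p c (X : 'M[quat R]_(m, n)) (Y : 'M[quat R]_(n, p)) :
  X *m (qreal c *: Y) = qreal c *: (X *m Y).
Proof.
apply/matrixP => i j; rewrite !mxE mulr_sumr; apply: eq_bigr => k _.
by rewrite mxE !mulrA qrealC.
Qed.

Lemma mul_mx_qreal m n c (X : 'M[quat R]_(m, n)) :
  X *m (qreal c)%:M = qreal c *: X.
Proof. by rewrite -scalemx1 mulmx_qreal mulmx1. Qed.

End MatrixDot.

(** * Inverses of positive definite quaternion matrices *)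

Section Inverse.
Context {R : realType}.

(** Quaternion columns as real matrices, the rows listing the four components;
    this reduces invertibility over the quaternions to linear algebra over a
    field. *)
Definition real_of_qcol n (x : 'cV[quat R]_n) : 'M[R]_(n, 4) :=
  \matrix_(i, a) [:: qre (x i 0); qi (x i 0); qj (x i 0); qk (x i 0)]`_a.
Definition qcol_of_real n (v : 'M[R]_(n, 4)) : 'cV[quat R]_n :=
  \col_i Quat (v i (inord 0)) (v i (inord 1)) (v i (inord 2)) (v i (inord 3)).

Lemma real_of_qcolK n : cancel (@real_of_qcol n) (@qcol_of_real n).
Proof.
move=> x; apply/matrixP => i j; rewrite (ord1 j) !mxE.
by apply: quat_eq; rewrite /= inordK.
Qed.

Lemma qcol_of_realK n : cancel (@qcol_of_real n) (@real_of_qcol n).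
Proof.
move=> v; apply/matrixP => i a; rewrite !mxE /=.
case: a => -[|[|[|[|a]]]] ha //=; congr (v _ _); apply: val_inj => /=.
- by rewrite inordK.
- by rewrite inordK.
- by rewrite inordK.
- by rewrite inordK.
Qed.

Definition real_mulmx n (P : 'M[quat R]_n) (v : 'M[R]_(n, 4)) : 'M[R]_(n, 4) :=
  real_of_qcol (P *m qcol_of_real v).

Lemma real_of_qcol_linear n (h : R) (x y : 'cV[quat R]_n) :
  real_of_qcol (qreal h *: x + y) = h *: real_of_qcol x + real_of_qcol y.
Proof.
apply/matrixP => i a; rewrite !mxE !qcompE /=.
by case: a => -[|[|[|[|a]]]] ha //=; ring.
Qed.

Lemma qcol_of_real_linear n (h : R) (x y : 'M[R]_(n, 4)) :
  qcol_of_real (h *: x + y) = qreal h *: qcol_of_real x + qcol_of_real y.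
Proof.
by apply/matrixP => i a; rewrite !mxE; apply: quat_eq; rewrite !qcompE /=; ring.
Qed.

Fact real_mulmx_linear n (P : 'M[quat R]_n) : linear (real_mulmx P).
Proof.
move=> h x y; rewrite /real_mulmx qcol_of_real_linear mulmxDr mulmx_qreal.
by rewrite real_of_qcol_linear.
Qed.
HB.instance Definition _ n (P : 'M[quat R]_n) :=
  GRing.isLinear.Build R 'M[R]_(n, 4) 'M[R]_(n, 4) _ (real_mulmx P)
    (real_mulmx_linear P).

(** An injective [P] acts on columns as an injective real-linear endomorphism of
    a finite-dimensional space, hence also surjectively; solving [P x = e_j] for
    each [j] gives a right inverse [Q], and injectivity cancels [P] in [P (Q P -
    1) = 0]. *)
Lemma qmx_inverse n (P : 'M[quat R]_n) :
  (forall x : 'cV[quat R]_n, P *m x = 0 -> x = 0) ->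
  exists Q, P *m Q = 1%:M /\ Q *m P = 1%:M.
Proof.
move=> Pinj.
have ker0 : lker (linfun (real_mulmx P)) == 0%VS.
  apply/lker0P => u v; rewrite !lfunE /= => /(can_inj (@real_of_qcolK n)) e.
  apply: (can_inj (@qcol_of_realK n)); apply/eqP; rewrite -subr_eq0; apply/eqP.
  by apply: Pinj; rewrite mulmxBr e subrr.
have surj (y : 'cV[quat R]_n) : exists x, P *m x = y.
  exists (qcol_of_real ((linfun (real_mulmx P))^-1%VF (real_of_qcol y))).
  apply: (can_inj (@real_of_qcolK n)); rewrite -/(real_mulmx P _).
  have := lker0_lfunVK ker0 (real_of_qcol y); by rewrite lfunE.
pose Q : 'M[quat R]_n := \matrix_(i, j) sval (cid (surj (col j 1%:M))) i 0.
have PQ : P *m Q = 1%:M.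
  apply/matrixP => i j; have := svalP (cid (surj (col j 1%:M))).
  move=> /(congr1 (fun X : 'cV[quat R]__ => X i 0)); rewrite !mxE => <-.
  by apply: eq_bigr => k _; rewrite !mxE.
exists Q; split=> //.
apply/eqP; rewrite -subr_eq0; apply/eqP.
have h : P *m (Q *m P - 1%:M) = 0.
  by rewrite mulmxBr mulmxA PQ mul1mx mulmx1 subrr.
apply/matrixP => i j.
have /(congr1 (fun X : 'cV[quat R]__ => X i 0)) : col j (Q *m P - 1%:M) = 0.
  apply: Pinj; apply/matrixP => a b; move/matrixP: h => /(_ a j).
  by rewrite !mxE => e; rewrite -[RHS]e; apply: eq_bigr => k _; rewrite !mxE.
by rewrite mxE [in X in _ = X]mxE => ->; rewrite mxE.
Qed.

Lemma qinvmxP n (P : 'M[quat R]_n) :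
  (forall x : 'cV[quat R]_n, P *m x = 0 -> x = 0) ->
  P *m qinvmx P = 1%:M /\ qinvmx P *m P = 1%:M.
Proof.
move=> /qmx_inverse[Q PQ].
by have := xgetPex P (ex_intro [set B | P *m B = 1%:M /\ B *m P = 1%:M] Q PQ).
Qed.

(** If [(X X^* + c) x = 0] then [|X^* x|^2 + c |x|^2 = 0]. *)
Lemma gram_inj m n (X : 'M[quat R]_(m, n)) c : 0 < c ->
  forall x : 'cV_m, (X *m ctrmx X + (qreal c)%:M) *m x = 0 -> x = 0.
Proof.
move=> c0 x /(congr1 (mxdot x)); rewrite mxdot0r mulmxDl mul_scalar_mx.
rewrite mxdotDr mxdotZr -mulmxA mxdot_adjl => /eqP.
rewrite paddr_eq0 ?mxdot_ge0 ?mulr_ge0 ?mxdot_ge0 ?ltW //.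
case/andP => _; rewrite mulf_eq0 gt_eqF //= => /eqP; exact: mxdot_eq0.
Qed.

End Inverse.

(** * Unitarity of the quaternion Fourier transform *)

Section Fourier.
Context {R : realType} (mu : quat R).
Hypothesis mu_unit_pure : unit_pure mu.

(** The exponential of [- mu x]: a unit pure quaternion generates a copy of the
    complex numbers, in which the transform is the usual one. *)
Definition qexp (x : R) : quat R := qreal (cos x) - mu * qreal (sin x).

Lemma unit_pure_dot : qdot mu mu = 1.
Proof. by rewrite -qnorm_sqr; case: mu_unit_pure => _ ->; rewrite expr1n. Qed.

Lemma qexpD x y : qexp (x + y) = qexp x * qexp y.
Proof.
have [re0 _] := mu_unit_pure; have := unit_pure_dot; rewrite /qexp.
case: mu re0 => a b c d /= ->; rewrite /qdot /= => h.
rewrite cosD sinD; apply: quat_eq; rewrite !qcompE /=; try by ring.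
have -> : cos x * cos y - sin x * sin y =
  cos x * cos y - (0 * 0 + b * b + c * c + d * d) * (sin x * sin y).
  by rewrite h mul1r.
by ring.
Qed.

Lemma qexp0 : qexp 0 = 1.
Proof. by rewrite /qexp cos0 sin0; apply: quat_eq; rewrite !qcompE /=; ring. Qed.

Lemma qexpN x : qexp (- x) = qconj (qexp x).
Proof.
have [re0 _] := mu_unit_pure; rewrite /qexp cosN sinN.
by apply: quat_eq; rewrite !qcompE /= re0; ring.
Qed.

Lemma qexpX x n : qexp (n%:R * x) = qexp x ^+ n.
Proof.
elim: n => [|n ih]; first by rewrite mul0r qexp0.
by rewrite exprS -ih -qexpD -[n.+1]add1n natrD mulrDl mul1r.
Qed.

Lemma qexp_2pi n : qexp (n%:R * (pi *+ 2)) = 1.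
Proof.
rewrite qexpX /qexp cos2pi sin2pi.
have -> : qreal 1 - mu * qreal 0 = 1 by apply: quat_eq; rewrite !qcompE /=; ring.
by rewrite expr1n.
Qed.

(** The half angle [y] is used because [1 - cos (2 y) = 2 sin^2 y], and the sine
    is positive on the open interval. *)
Lemma qexp_neq1 y : 0 < y < pi -> qexp (y *+ 2) <> 1.
Proof.
move=> /sin_gt0_pi s0 /(congr1 (@qre R)).
have [re0 _] := mu_unit_pure.
rewrite /qexp !qcompE /= re0 cos_mulr2n cos2sin2 => h.
have : sin y ^+ 2 = 0 by move: h; lra.
by move/eqP; rewrite sqrf_eq0 gt_eqF.
Qed.

Lemma qexp_conj1 x : qexp (- x) = 1 -> qexp x = 1.
Proof.
by rewrite qexpN => h; rewrite -[LHS]qconjK h; apply: quat_eq; rewrite !qcompE /= ?oppr0.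
Qed.

Definition dft_angle n (p q : nat) : R := 2 * pi * p%:R * q%:R / n%:R.

(** The terms are the powers of a nontrivial [n]-th root of unity when [p] and
    [s] differ, so the geometric sum vanishes. *)
Lemma dft_orthogonal n (p s : 'I_n) :
  \sum_(q < n) qexp (dft_angle n p q) * qconj (qexp (dft_angle n s q))
  = if p == s then qreal n%:R else 0.
Proof.
case: n p s => [|n] p s; first by case: p.
have n0 : (n.+1%:R : R) != 0 by rewrite pnatr_eq0.
pose y : R := pi * (p%:R - s%:R) / n.+1%:R.
have termE q : qexp (dft_angle n.+1 p q) * qconj (qexp (dft_angle n.+1 s q))
    = qexp (y *+ 2) ^+ q.
  rewrite -qexpN -qexpD -qexpX; congr (qexp _); rewrite /dft_angle /y.
  by rewrite mulr2n; field.
under eq_bigr do rewrite termE.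
case: eqP => [ps|/eqP ps].
  rewrite /y ps subrr mulr0 mul0r mul0rn qexp0.
  under eq_bigr do rewrite expr1n.
  rewrite sumr_const card_ord.
  have natE m : (1 : quat R) *+ m = qreal m%:R.
    elim: m => [|m ih]; first by [].
    by rewrite mulrS ih -[m.+1]add1n natrD qrealD.
  exact: natE.
have w1 : qexp (y *+ 2) <> 1.
  have := ltn_ord p; have := ltn_ord s; move: ps; rewrite -val_eqE /=.
  have rng (a b : nat) : (b < a < n.+1)%N ->
      0 < pi * (a%:R - b%:R) / (n.+1%:R : R) < pi.
    case/andP => ba an; have pi0 := pi_gt0 R.
    have n1 : 0 < n.+1%:R :> R by rewrite ltr0n.
    apply/andP; split; first by rewrite divr_gt0 ?mulr_gt0 ?subr_gt0 ?ltr_nat ?pi_gt0.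
    rewrite ltr_pdivrMr // ltr_pM2l //.
    by rewrite ltrBlDr ltr_wpDr // ltr_nat.
  rewrite neq_ltn => /orP[lt|lt] sn pn.
    move=> h; apply: (@qexp_neq1 (- y)).
      by rewrite /y -mulNr -mulrN opprB; apply: rng; rewrite lt sn.
    by apply: qexp_conj1; rewrite mulNrn opprK.
  by apply: qexp_neq1; apply: rng; rewrite lt pn.
have wn : qexp (y *+ 2) ^+ n.+1 = 1.
  rewrite -qexpX.
  have -> : n.+1%:R * (y *+ 2) = p%:R * (pi *+ 2) + - (s%:R * (pi *+ 2)).
    by rewrite /y !mulr2n; field.
  rewrite qexpD qexp_2pi mul1r; apply: qexp_conj1; rewrite opprK; exact: qexp_2pi.
set S := \sum_(q < _) _.
(* The norm is multiplicative, so one of the two factors vanishes. *)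
have : (qexp (y *+ 2) - 1) * S = 0 by rewrite -subrX1 wn subrr.
move=> h; have := qdotMM (qexp (y *+ 2) - 1) S; rewrite h qdot0l.
move/esym/eqP; rewrite mulf_eq0 => /orP[/eqP/qdot_eq0/eqP|/eqP/qdot_eq0 //].
by rewrite subr_eq0 => /eqP /w1.
Qed.

(** The transform without its factor [1 / sqrt n]: it is this matrix that [qdft]
    applies to the tubes. *)
Definition dft_kernel n : 'M[quat R]_n := \matrix_(p, q) qexp (dft_angle n p q).

Lemma qdft_kernelE n1 n2 n3 (X : tensor (quat R) n1 n2 n3) l i j :
  qdft mu X l i j = (dft_kernel n3 *m tube X i j) l 0.
Proof.
rewrite !(ffunE, mxE) mulr_sumr; apply: eq_bigr => q _.
rewrite !mxE !mulrA -qrealM divff ?mul1r //.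
rewrite sqrtr_eq0 -ltNge ltr0n; exact: leq_ltn_trans (ltn_ord q).
Qed.

(** The second identity follows from the first because the matrix is symmetric
    and its entries commute with each other. *)
Lemma dft_kernel_unitary n :
  dft_kernel n *m ctrmx (dft_kernel n) = (qreal n%:R)%:M /\
  ctrmx (dft_kernel n) *m dft_kernel n = (qreal n%:R)%:M.
Proof.
have H : dft_kernel n *m ctrmx (dft_kernel n) = (qreal n%:R)%:M.
  apply/matrixP => p s; rewrite !mxE.
  under eq_bigr do rewrite !mxE.
  by rewrite dft_orthogonal; case: eqP.
split=> //; rewrite -H; apply/matrixP => p s; rewrite !mxE.
have sym a b : dft_angle n a b = dft_angle n b a.
  by rewrite /dft_angle; congr (_ / _); ring.
under eq_bigr do rewrite !mxE (sym _ p) (sym _ s) -qexpN -qexpD addrC.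
under [RHS]eq_bigr do rewrite !mxE -qexpN -qexpD.
have orth (a b : 'I_n) : \sum_(q < n) qexp (dft_angle n a q + - dft_angle n b q)
    = if a == b then qreal n%:R else 0.
  by rewrite -dft_orthogonal; apply: eq_bigr => q _; rewrite qexpD qexpN.
by rewrite !orth (eq_sym s); case: eqP => // ->.
Qed.

Lemma qdft_sub n1 n2 n3 (X Y : tensor (quat R) n1 n2 n3) l :
  qdft mu (X - Y) l = qdft mu X l - qdft mu Y l.
Proof.
apply/matrixP => i j; rewrite [RHS]mxE [X in _ = _ + X]mxE [LHS]qdft_kernelE.
rewrite [X in _ = X + _]qdft_kernelE [X in _ = _ - X]qdft_kernelE.
have -> : tube (X - Y) i j = tube X i j - tube Y i j.
  by apply/matrixP => q z; rewrite !(ffunE, mxE).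
by rewrite mulmxBr !mxE.
Qed.

Definition tdot n1 n2 n3 (X Y : tensor (quat R) n1 n2 n3) : R :=
  \sum_l mxdot (X l) (Y l).

Lemma tfro_sqr n1 n2 n3 (X : tensor (quat R) n1 n2 n3) : tfro X ^+ 2 = tdot X X.
Proof.
have e : \sum_l \sum_i \sum_j qnorm (X l i j) ^+ 2 = tdot X X.
  apply: eq_bigr => l _; apply: eq_bigr => i _; apply: eq_bigr => j _.
  by rewrite qnorm_sqr.
by rewrite /tfro e sqr_sqrtr // sumr_ge0 // => l _; apply: mxdot_ge0.
Qed.

Lemma tdot_tubes n1 n2 n3 (X : tensor (quat R) n1 n2 n3) :
  tdot X X = \sum_i \sum_j mxdot (tube X i j) (tube X i j).
Proof.
rewrite /tdot /mxdot exchange_big; apply: eq_bigr => i _ /=.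
rewrite exchange_big; apply: eq_bigr => j _ /=.
by apply: eq_bigr => l _; rewrite big_ord1 !mxE.
Qed.

Lemma qdft_parseval n1 n2 n3 (X : tensor (quat R) n1 n2 n3) :
  tdot (qdft mu X) (qdft mu X) = n3%:R * tdot X X.
Proof.
rewrite !tdot_tubes mulr_sumr; apply: eq_bigr => i _; rewrite mulr_sumr.
apply: eq_bigr => j _.
have -> : tube (qdft mu X) i j = dft_kernel n3 *m tube X i j.
  by apply/matrixP => l z; rewrite (ord1 z) !mxE qdft_kernelE mxE.
rewrite mxdot_adjl mulmxA (dft_kernel_unitary n3).2 mul_scalar_mx.
by rewrite mxdotZl.
Qed.

Lemma qdft_surjective n1 n2 n3 (Y : tensor (quat R) n1 n2 n3) :
  exists X, qdft mu X = Y.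
Proof.
exists [ffun l => \matrix_(i, j)
  ((qreal n3%:R^-1 *: ctrmx (dft_kernel n3)) *m tube Y i j) l 0].
apply/ffunP => l; apply/matrixP => i j; rewrite qdft_kernelE.
set v := tube _ i j.
have -> : v = (qreal n3%:R^-1 *: ctrmx (dft_kernel n3)) *m tube Y i j.
  by apply/matrixP => q z; rewrite (ord1 z) mxE ffunE [LHS]mxE.
rewrite mulmxA mulmx_qreal (dft_kernel_unitary n3).1 scale_scalar_mx -qrealM.
rewrite mulVf ?mul1mx ?mxE // pnatr_eq0 -lt0n.
exact: leq_ltn_trans (ltn_ord l).
Qed.

Lemma qtprodP n1 n2 n3 (r : 'I_n3 -> nat) (A : forall l, 'M[quat R]_(n1, r l))
    (B : forall l, 'M[quat R]_(r l, n2)) l :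
  qdft mu (qtprod mu A B) l = A l *m B l.
Proof.
have [X XE] := qdft_surjective [ffun l => A l *m B l].
have := xgetPex 0 (ex_intro [set X | qdft mu X = [ffun l => A l *m B l]] X XE).
rewrite -[xget _ _]/(qtprod mu A B) => /= /(congr1 (fun f : {ffun _ -> _} => f l)).
by rewrite [in X in _ = X]ffunE.
Qed.

(** Parseval's identity turns the data term into a sum over slices that no
    longer mentions the inverse transform hidden in [qtprod]. *)
Lemma tfro_qtprod n1 n2 n3 (r : 'I_n3 -> nat) (A : forall l, 'M[quat R]_(n1, r l))
    (B : forall l, 'M[quat R]_(r l, n2)) (C : tensor (quat R) n1 n2 n3) :
  (0 < n3)%N ->
  tfro (qtprod mu A B - C) ^+ 2 = n3%:R^-1 *
    \sum_l mxdot (A l *m B l - qdft mu C l) (A l *m B l - qdft mu C l).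
Proof.
move=> n3_gt0; rewrite tfro_sqr; apply: (@mulfI _ n3%:R).
  by rewrite pnatr_eq0 -lt0n.
rewrite -qdft_parseval mulrA divff ?mul1r ?pnatr_eq0 -?lt0n //.
apply: eq_bigr => l _.
have e : qdft mu (qtprod mu A B - C) l = A l *m B l - qdft mu C l.
  by rewrite [LHS]qdft_sub; congr (_ - _); exact: (qtprodP A B l).
exact: (congr2 (@mxdot R n1 n2) e e).
Qed.

End Fourier.

(** * Polynomial functions of a real vector *)

Section RealVectors.
Context {R : realType} {N : nat}.
Implicit Types (u v w : 'rV[R]_N).

Lemma l2norm_ge0 v : 0 <= l2norm v.
Proof. exact: sqrtr_ge0. Qed.

Lemma l2norm_sqr v : l2norm v ^+ 2 = \sum_k v 0 k ^+ 2.
Proof. by rewrite sqr_sqrtr // sumr_ge0 // => k _; apply: sqr_ge0. Qed.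

Lemma coord_le_l2norm v k : `|v 0 k| <= l2norm v.
Proof.
rewrite -sqrtr_sqr ler_wsqrtr // (bigD1 k) //= lerDl.
by apply: sumr_ge0 => j _; apply: sqr_ge0.
Qed.

Lemma l2norm_le_sum v : l2norm v <= \sum_k `|v 0 k|.
Proof.
have s0 : 0 <= \sum_k `|v 0 k| by apply: sumr_ge0.
rewrite -[leRHS](ger0_norm s0) -sqrtr_sqr ler_wsqrtr //.
rewrite expr2 mulr_suml; apply: ler_sum => k _.
rewrite -[_ ^+ 2]real_normK ?num_real // expr2 ler_wpM2l // (bigD1 k) //= lerDl.
exact: sumr_ge0.
Qed.

Lemma l2norm_le u v : (forall k, `|u 0 k| <= `|v 0 k|) -> l2norm u <= l2norm v.
Proof.
move=> le; rewrite ler_wsqrtr //; apply: ler_sum => k _.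
rewrite -[X in X <= _]real_normK ?num_real // -[leRHS]real_normK ?num_real //.
by rewrite lerXn2r // nnegrE.
Qed.

(** An inductive characterisation, so that each property below is a structural
    induction and the polynomiality of an expression can be proved by following
    its syntax. *)
Inductive polyfun : ('rV[R]_N -> R) -> Prop :=
| poly_cst c : polyfun (fun=> c)
| poly_coord k : polyfun (fun v => v 0 k)
| poly_add f g : polyfun f -> polyfun g -> polyfun (fun v => f v + g v)
| poly_mul f g : polyfun f -> polyfun g -> polyfun (fun v => f v * g v).

Lemma polyfun_ext f g : polyfun f -> f =1 g -> polyfun g.
Proof. by move=> pf /funext <-. Qed.

Lemma poly_opp f : polyfun f -> polyfun (fun v => - f v).
Proof.
move=> pf; apply: (polyfun_ext (poly_mul (poly_cst (-1)) pf)) => v.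
by rewrite mulN1r.
Qed.

Lemma poly_sum I (s : seq I) (F : I -> 'rV[R]_N -> R) (P : pred I) :
  (forall i, polyfun (F i)) -> polyfun (fun v => \sum_(i <- s | P i) F i v).
Proof.
move=> pF; elim: s => [|i s ih].
  by apply: (polyfun_ext (poly_cst 0)) => v; rewrite big_nil.
case: (boolP (P i)) => Pi.
  by apply: (polyfun_ext (poly_add (pF i) ih)) => v; rewrite big_cons Pi.
by apply: (polyfun_ext ih) => v; rewrite big_cons (negPf Pi).
Qed.

Lemma polyfun_continuous f : polyfun f -> continuous f.
Proof.
elim=> [c|k|g h _ cg _ ch|g h _ cg _ ch] v.
- exact: (@cst_continuous _ _ c).
- exact: coord_continuous.
- exact: (continuousD (cg v) (ch v)).
- exact: (continuousM (cg v) (ch v)).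
Qed.

(** The product rule keeps directional derivatives inside the class, which
    therefore gives their continuity and Lipschitz bounds for free. *)
Lemma polyfun_derive f e : polyfun f ->
  polyfun (fun v => 'D_e f v) /\ (forall v, derivable f v e).
Proof.
elim=> [c|k|g h _ [pg dg] _ [ph dh]|g h pg [pg' dg] ph [ph' dh]].
- split; last by move=> v; exact: derivable_cst.
  by apply: (polyfun_ext (poly_cst 0)) => v; rewrite derive_cst.
- have lin v : is_derive v e (fun u : 'rV[R]_N => u 0 k) (e 0 k).
    have q h : h != 0 -> h^-1 *: ((h *: e + v) 0 k - v 0 k) = e 0 k.
      move=> h0; rewrite !mxE addrK.
      by rewrite /GRing.scale /= mulrA mulVf // mul1r.
    have cv : (fun h => h^-1 *: (((fun u : 'rV[R]_N => u 0 k) \o shift v) (h *: e)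
        - v 0 k)) @ 0^' --> e 0 k.
      apply: (@cvg_trans _ ((fun=> e 0 k) @ (0 : R)^')); last exact: cvg_cst.
      apply: near_eq_cvg; near=> h; rewrite /= q //.
      by near: h; exact: nbhs_dnbhs_neq.
    by apply: DeriveDef; [exact: (cvgP _ cv)|exact: (cvg_lim _ cv)].
  split; last by move=> v; have [] := lin v.
  apply: (polyfun_ext (poly_cst (e 0 k))) => v.
  by have [_ ->] := lin v.
- split; last by move=> v; apply: derivableD.
  by apply: (polyfun_ext (poly_add pg ph)) => v; rewrite -deriveD.
- split; last by move=> v; apply: derivableM.
  apply: (polyfun_ext (poly_add (poly_mul pg ph') (poly_mul ph pg'))) => v.
  by rewrite deriveM.
Unshelve. all: by end_near.
Qed.

Definition bounded_by (B : R) v := forall k, `|v 0 k| <= B.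

(** The bound on the values is proved together with the Lipschitz bound because
    the induction step for products needs it. *)
Lemma polyfun_locally_lipschitz f : polyfun f -> forall B, exists K,
  [/\ 0 <= K, forall u, bounded_by B u -> `|f u| <= K &
    forall u v, bounded_by B u -> bounded_by B v ->
      `|f u - f v| <= K * l2norm (u - v)].
Proof.
move=> + B; elim=> [c|k|g h _ [K [K0 Kg Lg]] _ [K' [K'0 Kh Lh]]
                    |g h _ [K [K0 Kg Lg]] _ [K' [K'0 Kh Lh]]].
- exists `|c|; split=> // u v _ _; rewrite subrr normr0.
  by rewrite mulr_ge0 // l2norm_ge0.
- exists (Num.max 1 B); split.
  + by rewrite le_max ler01.
  + by move=> u /(_ k) h; rewrite le_max h orbT.
  + move=> u v _ _; have := coord_le_l2norm (u - v) k; rewrite !mxE => h.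
    apply: le_trans h _; rewrite ler_peMl ?l2norm_ge0 // le_max lexx //.
- exists (K + K'); split; first exact: addr_ge0.
  + by move=> u bu; apply: le_trans (ler_normD _ _) _; rewrite lerD ?Kg ?Kh.
  + move=> u v bu bv; rewrite opprD addrACA mulrDl.
    by apply: le_trans (ler_normD _ _) _; rewrite lerD ?Lg ?Lh.
- exists (K * K' + K * K'); split; first by rewrite addr_ge0 ?mulr_ge0.
  + move=> u bu; rewrite normrM.
    apply: (@le_trans _ _ (K * K')); first by rewrite ler_pM ?Kg ?Kh.
    by rewrite lerDl mulr_ge0.
  + move=> u v bu bv.
    have -> : g u * h u - g v * h v = g u * (h u - h v) + (g u - g v) * h v by ring.
    apply: le_trans (ler_normD _ _) _; rewrite !normrM mulrDl.
    apply: lerD; first by rewrite -mulrA ler_pM ?Kg ?Lh.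
    by rewrite mulrAC ler_pM ?Kh ?Lg.
Qed.

(** All partial derivatives of the objective are read off its quadratic
    expansion along a line through this lemma. *)
Lemma derive_quadratic f v e a q :
  (forall h, f (v + h *: e) = f v + h * a + h ^+ 2 * q) -> 'D_e f v = a.
Proof.
move=> fE; apply: cvg_lim => //.
have cv : (fun h : R => a + h * q) @ 0^' --> a.
  apply: cvg_within_filter.
  have : {for (0 : R), continuous (fun h : R => a + h * q)}.
    apply: continuousD; first exact: cst_continuous.
    by apply: continuousM; [exact: cvg_id|exact: cst_continuous].
  rewrite /prop_for /continuous_at /= => c0; have aE : a + 0 * q = a by ring.
  by rewrite aE in c0.
apply: cvg_trans cv; apply: near_eq_cvg; near=> h.
rewrite /= (addrC (h *: e)) fE /GRing.scale /=.
have h0 : h != 0 by near: h; exact: nbhs_dnbhs_neq.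
by field.
Unshelve. all: by end_near.
Qed.

(** A continuous function maps a cluster point of a sequence to a cluster point
    of the image, which is the limit when the image converges. *)
Lemma cluster_limit (F : 'rV[R]_N -> R) (z : nat -> 'rV[R]_N) zs l :
  continuous F -> cluster (z @ \oo) zs -> F (z t) @[t --> \oo] --> l -> F zs = l.
Proof.
move=> cF cz Fl; apply/eqP; rewrite -subr_eq0 -normr_le0.
apply/ler_addgt0Pl => e e0; rewrite addr0.
have e20 : 0 < e / 2 by rewrite divr_gt0.
have A : \forall t \near \oo, `|l - F (z t)| < e / 2.
  by move/cvgrPdist_lt: Fl; apply.
have B : \forall v \near zs, `|F zs - F v| < e / 2.
  by have /cvgrPdist_lt := cF zs; apply.
have [v [/= lv zv]] := cz [set v | `|l - F v| < e / 2] _ A B.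
have -> : F zs - l = (F zs - F v) - (l - F v) by ring.
rewrite (splitr e); apply: le_trans (ler_normB _ _) _.
by rewrite lerD // ltW.
Qed.

End RealVectors.

(** * Descent sequences with small partial derivatives *)

Section Descent.
Context {R : realType} {N : nat}.
Implicit Types (u v w : 'rV[R]_N).

(** The values [f (z t)] decrease and are bounded below, so their consecutive
    differences tend to zero. *)
Lemma sufficient_decrease_cvg0 (f : 'rV[R]_N -> R) (d : nat -> R) (z : nat -> 'rV[R]_N) c :
  (forall v, 0 <= f v) -> 0 < c -> (forall t, 0 <= d t) ->
  (forall t, c * d t ^+ 2 <= f (z t) - f (z t.+1)) ->
  d t @[t --> \oo] --> 0.
Proof.
move=> f0 c0 d0 dec.
have cf : cvgn (f \o z).
  apply: nonincreasing_is_cvgn.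
    apply/nonincreasing_seqP => t; rewrite /= -subr_ge0.
    by apply: le_trans (dec t); rewrite mulr_ge0 ?sqr_ge0 // ltW.
  by exists 0 => _ [t _ <-]; apply: f0.
have cf' : f (z t.+1) @[t --> \oo] --> limn (f \o z).
  by have := cf; rewrite -(cvg_shiftS (f \o z)).
have cg : (c^-1 * (f (z t) - f (z t.+1))) @[t --> \oo] --> 0.
  rewrite -(mulr0 c^-1) -(subrr (limn (f \o z))).
  by apply: cvgM; [exact: cvg_cst|apply: cvgB].
(* The step length is at most the square root of the decrease divided by c. *)
have cs : Num.sqrt (c^-1 * (f (z t) - f (z t.+1))) @[t --> \oo] --> 0.
  have := cvg_comp _ _ cg (@sqrt_continuous R 0).
  by rewrite sqrtr0.
apply: (squeeze_cvgr _ (cvg_cst 0) cs); near=> t.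
rewrite d0 /= -[leLHS]ger0_norm // -sqrtr_sqr ler_wsqrtr //.
by rewrite ler_pdivlMl.
Unshelve. all: by end_near.
Qed.

Lemma l2norm_bigO (g : nat -> 'rV[R]_N) (d : nat -> R) :
  (forall k, exists K, forall t, `|g t 0 k| <= K * d t) ->
  exists K, forall t, l2norm (g t) <= K * d t.
Proof.
move=> /choice[K gK]; exists (\sum_k K k) => t.
apply: le_trans (l2norm_le_sum _) _.
by rewrite mulr_suml; apply: ler_sum => k _.
Qed.

(** The partial derivatives are only known to be small at points [w] that mix
    the coordinates of two consecutive iterates. Such a point lies within the
    step length of [z t], so the Lipschitz bound of the partial derivative
    transfers the estimate to [z t]; the step length tends to zero by the
    decrease of [f]. *)
Lemma descent_criterion (f : 'rV[R]_N -> R) (free : pred 'I_N)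
    (z : nat -> 'rV[R]_N) (B c : R) :
  polyfun f -> (forall v, 0 <= f v) -> (forall t, bounded_by B (z t)) -> 0 < c ->
  (forall t, c * l2norm (z t - z t.+1) ^+ 2 <= f (z t) - f (z t.+1)) ->
  (forall k, free k -> exists L, forall t, exists w,
     (forall j, w 0 j = z t 0 j \/ w 0 j = z t.+1 0 j) /\
     `|'D_(delta_mx 0 k) f w| <= L * l2norm (z t - z t.+1)) ->
  forall k, free k ->
    (exists K, forall t,
       `|'D_(delta_mx 0 k) f (z t)| <= K * l2norm (z t - z t.+1)) /\
    (forall zs, cluster (z @ \oo) zs -> 'D_(delta_mx 0 k) f zs = 0).
Proof.
move=> pf f0 bz c0 dec crit k fk.
have [pD _] := polyfun_derive (delta_mx 0 k) pf.
have [L crit_k] := crit k fk.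
have [K [K0 _ lipD]] := polyfun_locally_lipschitz pD B.
have DO t : `|'D_(delta_mx 0 k) f (z t)| <= (K + L) * l2norm (z t - z t.+1).
  have [w [mixw Dw]] := crit_k t.
  have bw : bounded_by B w by move=> j; case: (mixw j) => ->; apply: bz.
  have -> : 'D_(delta_mx 0 k) f (z t) =
     ('D_(delta_mx 0 k) f (z t) - 'D_(delta_mx 0 k) f w) + 'D_(delta_mx 0 k) f w.
    by rewrite subrK.
  apply: le_trans (ler_normD _ _) _; rewrite mulrDl lerD //.
  apply: le_trans (lipD _ _ (bz t) bw) _; rewrite ler_wpM2l //.
  apply: l2norm_le => j; rewrite !mxE.
  by case: (mixw j) => -> //; rewrite subrr normr0.
split; first by exists (K + L).
move=> zs czs; apply: (cluster_limit (polyfun_continuous pD) czs).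
apply: norm_cvg0.
have d0 := sufficient_decrease_cvg0 f0 c0 (fun t => l2norm_ge0 (z t - z t.+1)) dec.
have cs : ((K + L) * l2norm (z t - z t.+1)) @[t --> \oo] --> 0.
  by rewrite -(mulr0 (K + L)); apply: cvgM d0; exact: cvg_cst.
apply: (squeeze_cvgr _ (cvg_cst 0) cs); near=> t.
by rewrite normr_ge0 DO.
Unshelve. all: by end_near.
Qed.

End Descent.

(** * Real coordinates of the three blocks *)

Section QuaternionPolynomials.
Context {R : realType} {N : nat}.

Definition polyquat (g : 'rV[R]_N -> quat R) :=
  [/\ polyfun (fun v => qre (g v)), polyfun (fun v => qi (g v)),
      polyfun (fun v => qj (g v)) & polyfun (fun v => qk (g v))].

Lemma polyquat_ext g h : polyquat g -> g =1 h -> polyquat h.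
Proof. by move=> pg /funext <-. Qed.

Lemma polyquat_cst p : polyquat (fun=> p).
Proof. by split; apply: poly_cst. Qed.

Lemma polyquat_add g h : polyquat g -> polyquat h -> polyquat (fun v => g v + h v).
Proof.
by move=> [g1 g2 g3 g4] [h1 h2 h3 h4]; split; apply: poly_add.
Qed.

Lemma polyquat_opp g : polyquat g -> polyquat (fun v => - g v).
Proof. by move=> [g1 g2 g3 g4]; split; apply: poly_opp. Qed.

Lemma polyquat_mul g h : polyquat g -> polyquat h -> polyquat (fun v => g v * h v).
Proof.
move=> [g1 g2 g3 g4] [h1 h2 h3 h4].
by split; rewrite /=; repeat
  (first [apply: poly_add | apply: poly_opp | apply: poly_mul | assumption]).
Qed.

Lemma polyquat_sum (I : finType) (F : I -> 'rV[R]_N -> quat R) :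
  (forall i, polyquat (F i)) -> polyquat (fun v => \sum_i F i v).
Proof.
move=> pF; elim: (index_enum I) => [|i s ih].
  by apply: (polyquat_ext (polyquat_cst 0)) => v; rewrite big_nil.
by apply: (polyquat_ext (polyquat_add (pF i) ih)) => v; rewrite big_cons.
Qed.

Lemma poly_qdot g h : polyquat g -> polyquat h -> polyfun (fun v => qdot (g v) (h v)).
Proof.
move=> [g1 g2 g3 g4] [h1 h2 h3 h4].
by rewrite /qdot; repeat
  (first [apply: poly_add | apply: poly_opp | apply: poly_mul | assumption]).
Qed.

Definition polymx m n (U : 'rV[R]_N -> 'M[quat R]_(m, n)) :=
  forall i j, polyquat (fun v => U v i j).

Lemma polymx_sub m n (U V : 'rV[R]_N -> 'M[quat R]_(m, n)) :
  polymx U -> polymx V -> polymx (fun v => U v - V v).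
Proof.
move=> pU pV i j.
apply: (polyquat_ext (polyquat_add (pU i j) (polyquat_opp (pV i j)))) => v.
by rewrite !mxE.
Qed.

Lemma polymx_mul m n p (U : 'rV[R]_N -> 'M[quat R]_(m, n))
    (V : 'rV[R]_N -> 'M[quat R]_(n, p)) :
  polymx U -> polymx V -> polymx (fun v => U v *m V v).
Proof.
move=> pU pV i j.
apply: (polyquat_ext (polyquat_sum (fun k => polyquat_mul (pU i k) (pV k j)))) => v.
by rewrite !mxE.
Qed.

Lemma poly_mxdot m n (U : 'rV[R]_N -> 'M[quat R]_(m, n)) :
  polymx U -> polyfun (fun v => mxdot (U v) (U v)).
Proof. by move=> pU; do 2![apply: poly_sum => ?]; apply: poly_qdot. Qed.

End QuaternionPolynomials.

Section Coordinates.
Context {R : realType} {n1 n2 n3 : nat} {r : 'I_n3 -> nat}.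
Implicit Types (u v w z : zvec R n1 n2 r) (x : zidx n1 n2 r).

Lemma zcoord_line w v h x : zcoord (w + h *: v) x = zcoord w x + h * zcoord v x.
Proof. by rewrite /zcoord !mxE. Qed.

Lemma zCE u l i j : zC u l i j = Quat 0 (zcoord u (inl (inl (inord 0, (i, j, l)))))
  (zcoord u (inl (inl (inord 1, (i, j, l)))))
  (zcoord u (inl (inl (inord 2, (i, j, l))))).
Proof. by rewrite !(ffunE, mxE). Qed.

Lemma zC_line w v h l : zC (w + h *: v) l = zC w l + qreal h *: zC v l.
Proof.
apply/matrixP => i j; rewrite 2!mxE !zCE !zcoord_line.
by apply: quat_eq; rewrite !qcompE /=; ring.
Qed.

Lemma zA_line w v h l : zA (w + h *: v) l = zA w l + qreal h *: zA v l.
Proof.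
apply/matrixP => i j; rewrite !mxE /= !zcoord_line.
by apply: quat_eq; rewrite !qcompE /=; ring.
Qed.

Lemma zB_line w v h l : zB (w + h *: v) l = zB w l + qreal h *: zB v l.
Proof.
apply/matrixP => i j; rewrite !mxE /= !zcoord_line.
by apply: quat_eq; rewrite !qcompE /=; ring.
Qed.

Lemma sum_inord n (F : 'I_n.+1 -> R) : \sum_a F a = \sum_(0 <= a < n.+1) F (inord a).
Proof. by rewrite big_mkord; apply: eq_bigr => a _; rewrite inord_val. Qed.

Lemma sum_pair (I J : finType) (F : I * J -> R) : \sum_x F x = \sum_i \sum_j F (i, j).
Proof. by rewrite pair_bigA; apply: eq_bigr => -[]. Qed.

Lemma sum_tagged (I : finType) (J : I -> finType) (F : {i : I & J i} -> R) :
  \sum_x F x = \sum_i \sum_(j : J i) F (Tagged (fun i => J i) j).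
Proof. by rewrite sig_big_dep; apply: eq_bigr => -[]. Qed.

Lemma tdot_zC u v : tdot (zC u) (zC v) =
  \sum_x zcoord u (inl (inl x)) * zcoord v (inl (inl x)).
Proof.
rewrite sum_pair exchange_big sum_pair exchange_big; apply: eq_bigr => l _ /=.
rewrite sum_pair; apply: eq_bigr => i _; apply: eq_bigr => j _.
by rewrite sum_inord !big_nat_recr //= big_geq // !zCE /qdot /=; ring.
Qed.

Lemma sum_mxdot_zA u v : \sum_l mxdot (zA u l) (zA v l) =
  \sum_x zcoord u (inl (inr x)) * zcoord v (inl (inr x)).
Proof.
rewrite sum_tagged; apply: eq_bigr => l _; rewrite sum_pair exchange_big sum_pair.
apply: eq_bigr => i _; apply: eq_bigr => j _.
by rewrite sum_inord !big_nat_recr //= big_geq // !mxE /qdot /=; ring.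
Qed.

Lemma sum_mxdot_zB u v : \sum_l mxdot (zB u l) (zB v l) =
  \sum_x zcoord u (inr x) * zcoord v (inr x).
Proof.
rewrite sum_tagged; apply: eq_bigr => l _; rewrite sum_pair exchange_big sum_pair.
apply: eq_bigr => i _; apply: eq_bigr => j _.
by rewrite sum_inord !big_nat_recr //= big_geq // !mxE /qdot /=; ring.
Qed.

(** The Euclidean norm of the vector of real components is the joint Frobenius
    norm of the three blocks: this links the estimates on matrices to the norm
    in the theorem. *)
Lemma l2norm_blocks u : l2norm u ^+ 2 =
  tdot (zC u) (zC u) + \sum_l mxdot (zA u l) (zA u l) + \sum_l mxdot (zB u l) (zB u l).
Proof.
rewrite l2norm_sqr tdot_zC sum_mxdot_zA sum_mxdot_zB (reindex (@enum_rank (zidx n1 n2 r))) /=.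
  by rewrite !big_sumType.
exact: onW_bij (enum_rank_bij _).
Qed.

(** Updating one block of variables after another passes through such points. *)
Definition zsplice (S : pred (zidx n1 n2 r)) u v : zvec R n1 n2 r :=
  \row_k if S (enum_val k) then v 0 k else u 0 k.

Lemma zcoord_splice S u v x :
  zcoord (zsplice S u v) x = if S x then zcoord v x else zcoord u x.
Proof. by rewrite /zcoord !mxE enum_rankK. Qed.

Lemma eq_zC u v : (forall y, zcoord u (inl (inl y)) = zcoord v (inl (inl y))) ->
  zC u = zC v.
Proof. by move=> e; apply/ffunP => l; apply/matrixP => i j; rewrite !zCE !e. Qed.

Lemma eq_zA u v : (forall y, zcoord u (inl (inr y)) = zcoord v (inl (inr y))) ->
  zA u = zA v.
Proof.
by move=> e; apply/functional_extensionality_dep => l; apply/matrixP => i j;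
  rewrite !mxE /= !e.
Qed.

Lemma eq_zB u v : (forall y, zcoord u (inr y) = zcoord v (inr y)) -> zB u = zB v.
Proof.
by move=> e; apply/functional_extensionality_dep => l; apply/matrixP => i j;
  rewrite !mxE /= !e.
Qed.

Lemma poly_zcoord x : polyfun (fun z => zcoord z x).
Proof. exact: poly_coord. Qed.

Lemma poly_zC l : polymx (fun z => zC z l).
Proof.
move=> i j; apply: (@polyquat_ext _ _ (fun z => Quat 0
  (zcoord z (inl (inl (inord 0, (i, j, l)))))
  (zcoord z (inl (inl (inord 1, (i, j, l)))))
  (zcoord z (inl (inl (inord 2, (i, j, l)))))));
  last by move=> z; rewrite zCE.
by split; [exact: poly_cst|exact: poly_coord..].
Qed.

Lemma poly_zA l : polymx (fun z => zA z l).
Proof.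
move=> i j; pose c a z := zcoord z
  (inl (inr (Tagged (fun l => ('I_4 * ('I_n1 * 'I_(r l)))%type) (inord a, (i, j))))).
apply: (@polyquat_ext _ _ (fun z => Quat (c 0%N z) (c 1%N z) (c 2%N z) (c 3%N z))).
  by split; exact: poly_coord.
by move=> z; rewrite mxE.
Qed.

Lemma poly_zB l : polymx (fun z => zB z l).
Proof.
move=> i j; pose c a z := zcoord z
  (inr (Tagged (fun l => ('I_4 * ('I_(r l) * 'I_n2))%type) (inord a, (i, j)))).
apply: (@polyquat_ext _ _ (fun z => Quat (c 0%N z) (c 1%N z) (c 2%N z) (c 3%N z))).
  by split; exact: poly_coord.
by move=> z; rewrite mxE.
Qed.

End Coordinates.

(** * The objective along block directions *)

Section Quadratic.
Context {R : realType}.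

(** The linear coefficient is left existential: on the [C] block only the
    leading coefficient matters, since the optimality of the update determines
    the linear one. *)
Definition quadratic (phi : R -> R) (q : R) :=
  exists a, forall h, phi h = phi 0 + h * a + h ^+ 2 * q.

Lemma quadratic_ext phi psi q : quadratic phi q -> phi =1 psi -> quadratic psi q.
Proof. by move=> qp /funext <-. Qed.

Lemma quadratic_cst c : quadratic (fun=> c) 0.
Proof. by exists 0 => h; rewrite !mulr0 !addr0. Qed.

Lemma quadratic_add phi psi q s : quadratic phi q -> quadratic psi s ->
  quadratic (fun h => phi h + psi h) (q + s).
Proof. by move=> [a pa] [b pb]; exists (a + b) => h; rewrite pa pb; ring. Qed.

Lemma quadratic_scale c phi q : quadratic phi q ->
  quadratic (fun h => c * phi h) (c * q).
Proof. by move=> [a pa]; exists (c * a) => h; rewrite pa; ring. Qed.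

Lemma quadratic_sum I (s : seq I) (P : pred I) (F : I -> R -> R) (q : I -> R) :
  (forall i, quadratic (F i) (q i)) ->
  quadratic (fun h => \sum_(i <- s | P i) F i h) (\sum_(i <- s | P i) q i).
Proof.
move=> qF; elim: s => [|i s ih].
  rewrite big_nil; apply: (quadratic_ext (quadratic_cst 0)) => h.
  by rewrite big_nil.
rewrite big_cons; case: (boolP (P i)) => Pi.
  by apply: (quadratic_ext (quadratic_add (qF i) ih)) => h; rewrite big_cons Pi.
by apply: (quadratic_ext ih) => h; rewrite big_cons (negPf Pi).
Qed.

Lemma quadratic_mxdot m n (U : R -> 'M[quat R]_(m, n)) X Y :
  (forall h, U h = X + qreal h *: Y) ->
  quadratic (fun h => mxdot (U h) (U h)) (mxdot Y Y).
Proof.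
move=> /funext ->; exists (2 * mxdot X Y) => h.
rewrite [LHS]mxdot_line [X in _ = X + _ + _]mxdot_line.
by rewrite expr0n /= !mul0r !addr0.
Qed.

Lemma sum_mxdot_line (I : finType) (m n : I -> nat) h
    (U X Y : forall l, 'M[quat R]_(m l, n l)) :
  (forall l, U l = X l + qreal h *: Y l) ->
  \sum_l mxdot (U l) (U l) = \sum_l mxdot (X l) (X l)
    + h * (2 * \sum_l mxdot (X l) (Y l)) + h ^+ 2 * \sum_l mxdot (Y l) (Y l).
Proof.
move=> UE; rewrite !mulr_sumr -!big_split; apply: eq_bigr => l _ /=.
by rewrite UE mxdot_line.
Qed.

End Quadratic.

Section Objective.
Context {R : realType} {n1 n2 n3 : nat} {r : 'I_n3 -> nat}.
Variables (mu : quat R) (lam lam1 lam2 : R).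
Hypotheses (mu_unit_pure : unit_pure mu) (n3_gt0 : (0 < n3)%N).
Hypotheses (lam_gt0 : 0 < lam) (lam1_gt0 : 0 < lam1) (lam2_gt0 : 0 < lam2).
Implicit Types (u v w z E : zvec R n1 n2 r).
Local Notation f := (objective mu lam lam1 lam2).

Lemma TVE (C : tensor (quat R) n1 n2 n3) : TV lam1 lam2 C =
  lam1 * (\sum_(k < n1) \sum_(k' < n1 | k' == k.+1 :> nat)
            mxdot (hslice C k - hslice C k') (hslice C k - hslice C k'))
  + lam2 * (\sum_(k < n2) \sum_(k' < n2 | k' == k.+1 :> nat)
            mxdot (lslice C k - lslice C k') (lslice C k - lslice C k')).
Proof.
by congr (_ * _ + _ * _); apply: eq_bigr => k _; apply: eq_bigr => k' _;
  rewrite mxfro_sqr.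
Qed.

Lemma TV_ge0 (C : tensor (quat R) n1 n2 n3) : 0 <= TV lam1 lam2 C.
Proof.
by rewrite TVE; apply: addr_ge0; apply: mulr_ge0 (ltW _) _ => //;
  apply: sumr_ge0 => k _; apply: sumr_ge0 => k' _; apply: mxdot_ge0.
Qed.

Lemma quadratic_TV w E :
  quadratic (fun h => TV lam1 lam2 (zC (w + h *: E))) (TV lam1 lam2 (zC E)).
Proof.
rewrite TVE; apply: (@quadratic_ext _ (fun h => _)); last by move=> h; rewrite TVE.
apply: quadratic_add; apply: quadratic_scale; do 2![apply: quadratic_sum => ?].
- apply: (@quadratic_mxdot _ _ _ _ (hslice (zC w) _ - hslice (zC w) _)) => h.
  by apply/matrixP => i j; rewrite !mxE !zC_line !mxE mulrBr opprD addrACA.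
- apply: (@quadratic_mxdot _ _ _ _ (lslice (zC w) _ - lslice (zC w) _)) => h.
  by apply/matrixP => i j; rewrite !mxE !zC_line !mxE mulrBr opprD addrACA.
Qed.

Lemma poly_TV : polyfun (fun z : zvec R n1 n2 r => TV lam1 lam2 (zC z)).
Proof.
apply: (@polyfun_ext _ _ (fun z => _)); last by move=> z; rewrite TVE.
apply: poly_add; apply: poly_mul; try exact: poly_cst;
  do 2![apply: poly_sum => ?]; apply: poly_mxdot; apply: polymx_sub => i j.
- by apply: (polyquat_ext (poly_zC j _ i)) => z; rewrite mxE.
- by apply: (polyquat_ext (poly_zC j _ i)) => z; rewrite mxE.
- by apply: (polyquat_ext (poly_zC j i _)) => z; rewrite mxE.
- by apply: (polyquat_ext (poly_zC j i _)) => z; rewrite mxE.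
Qed.

Definition resid z l := zA z l *m zB z l - qdft mu (zC z) l.

Lemma objectiveE z : f z =
  (2 * n3%:R)^-1 * (\sum_l mxdot (resid z l) (resid z l)
     + lam * (\sum_l mxdot (zA z l) (zA z l) + \sum_l mxdot (zB z l) (zB z l)))
  + TV lam1 lam2 (zC z).
Proof.
rewrite /objective tfro_qtprod //.
under [\sum_l mxfro (zA z l) ^+ 2]eq_bigr do rewrite mxfro_sqr.
under [\sum_l mxfro (zB z l) ^+ 2]eq_bigr do rewrite mxfro_sqr.
rewrite [in RHS]mulrDr; congr (_ + _ + _); first by rewrite invfM mulrA.
by rewrite mulrA [_ * lam]mulrC.
Qed.

Lemma poly_resid l : polymx (fun z => resid z l).
Proof.
apply: polymx_sub; first by apply: polymx_mul; [exact: poly_zA|exact: poly_zB].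
move=> i j; apply: (@polyquat_ext _ _ (fun z =>
  \sum_q dft_kernel mu n3 l q * zC z q i j)).
  apply: polyquat_sum => q; apply: polyquat_mul; last exact: poly_zC.
  exact: polyquat_cst.
move=> z; rewrite [RHS]qdft_kernelE mxE; apply: eq_bigr => q _.
by rewrite [X in _ = _ * X]mxE.
Qed.

Lemma poly_objective : polyfun (f : zvec R n1 n2 r -> R).
Proof.
apply: (@polyfun_ext _ _ (fun z => _)); last by move=> z; rewrite objectiveE.
apply: poly_add; last exact: poly_TV.
apply: poly_mul; first exact: poly_cst.
apply: poly_add; first by apply: poly_sum => l; apply/poly_mxdot/poly_resid.
apply: poly_mul; first exact: poly_cst.
by apply: poly_add; apply: poly_sum => l; apply: poly_mxdot;
  [exact: poly_zA|exact: poly_zB].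
Qed.

Lemma objective_ge0 z : 0 <= f z.
Proof.
have s0 m n (U : forall l : 'I_n3, 'M[quat R]_(m l, n l)) :
    0 <= \sum_l mxdot (U l) (U l).
  by apply: sumr_ge0 => l _; apply: mxdot_ge0.
rewrite objectiveE addr_ge0 ?TV_ge0 // mulr_ge0 //.
apply: addr_ge0; first exact: (s0 _ _ (resid z)).
apply: mulr_ge0; first exact: ltW.
by apply: addr_ge0; [exact: (s0 _ _ (zA z))|exact: (s0 _ _ (zB z))].
Qed.

(** The leading coefficient is at least half of the squared norm of the
    direction: this is the strong convexity of the [C] subproblem. *)
Lemma objective_lineC w E :
  (forall l, zA E l = 0) -> (forall l, zB E l = 0) ->
  quadratic (fun h => f (w + h *: E))
    (2^-1 * tdot (zC E) (zC E) + TV lam1 lam2 (zC E)).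
Proof.
move=> A0 B0.
have eA h : zA (w + h *: E) = zA w.
  by apply/functional_extensionality_dep => l; rewrite zA_line A0 scaler0 addr0.
have eB h : zB (w + h *: E) = zB w.
  by apply/functional_extensionality_dep => l; rewrite zB_line B0 scaler0 addr0.
pose P := qtprod mu (zA w) (zB w).
pose g := lam / (2 * n3%:R) * (\sum_l mxfro (zA w l) ^+ 2 + \sum_l mxfro (zB w l) ^+ 2).
apply: (@quadratic_ext _ (fun h => 2^-1 * tdot (P - zC (w + h *: E)) (P - zC (w + h *: E))
  + g + TV lam1 lam2 (zC (w + h *: E)))); last first.
  by move=> h; rewrite /objective eA eB tfro_sqr.
apply: quadratic_add; last exact: quadratic_TV.
rewrite -[_ * tdot _ _]addr0; apply: quadratic_add; last exact: quadratic_cst.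
apply: quadratic_scale; apply: quadratic_sum => l.
have -> : mxdot (zC E l) (zC E l) = mxdot (- zC E l) (- zC E l).
  by apply: eq_bigr => i _; apply: eq_bigr => j _; rewrite !mxE /qdot !qcompE; ring.
apply: (@quadratic_mxdot _ _ _ _ (P l - zC w l)) => h.
by rewrite 2!ffunE zC_line scalerN opprD addrA.
Qed.

(** The gradient of [n3 * f] in the block [A^(l)]. *)
Definition gradA w l := resid w l *m ctrmx (zB w l) + qreal lam *: zA w l.
(** The gradient of [n3 * f] in the block [B^(l)]. *)
Definition gradB w l := ctrmx (zA w l) *m resid w l + qreal lam *: zB w l.

Lemma zC_fixed w E h : (forall l, zC E l = 0) -> zC (w + h *: E) = zC w.
Proof. by move=> C0; apply/ffunP => l; rewrite zC_line C0 scaler0 addr0. Qed.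

Lemma objective_lineA w E :
  (forall l, zC E l = 0) -> (forall l, zB E l = 0) ->
  exists2 q, 0 <= q & forall h, f (w + h *: E) =
    f w + h * (n3%:R^-1 * \sum_l mxdot (gradA w l) (zA E l)) + h ^+ 2 * q.
Proof.
move=> C0 B0.
exists ((2 * n3%:R)^-1 * (\sum_l mxdot (zA E l *m zB w l) (zA E l *m zB w l)
  + lam * \sum_l mxdot (zA E l) (zA E l))).
  apply: mulr_ge0 => //; apply: addr_ge0; last apply: (mulr_ge0 (ltW lam_gt0)).
    by apply: sumr_ge0 => l _; apply: mxdot_ge0.
  by apply: sumr_ge0 => l _; apply: mxdot_ge0.
move=> h; rewrite !objectiveE zC_fixed //.
have eB : zB (w + h *: E) = zB w.
  by apply/functional_extensionality_dep => l; rewrite zB_line B0 scaler0 addr0.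
have eR l : resid (w + h *: E) l = resid w l + qreal h *: (zA E l *m zB w l).
  by rewrite /resid zC_fixed // eB zA_line mulmxDl -scalemxAl addrAC.
have e1 := sum_mxdot_line eR.
have e2 := sum_mxdot_line (zA_line w E h).
have e3 : \sum_l mxdot (gradA w l) (zA E l) =
    \sum_l mxdot (resid w l) (zA E l *m zB w l) + lam * \sum_l mxdot (zA w l) (zA E l).
  rewrite mulr_sumr -big_split; apply: eq_bigr => l _ /=.
  by rewrite mxdotDl mxdotZl; congr (_ + _); rewrite [RHS]mxdot_adjr.
rewrite eB [X in _ * (X + _) + _ = _]e1 [X in _ * (_ + _ * (X + _)) + _ = _]e2.
rewrite [X in _ = _ + _ * (_ * X) + _]e3.
rewrite (_ : n3%:R^-1 = 2 * (2 * n3%:R)^-1); last first.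
  by rewrite invfM mulrA divff ?mul1r // pnatr_eq0.
by ring.
Qed.

Lemma objective_lineB w E :
  (forall l, zC E l = 0) -> (forall l, zA E l = 0) ->
  exists2 q, 0 <= q & forall h, f (w + h *: E) =
    f w + h * (n3%:R^-1 * \sum_l mxdot (gradB w l) (zB E l)) + h ^+ 2 * q.
Proof.
move=> C0 A0.
exists ((2 * n3%:R)^-1 * (\sum_l mxdot (zA w l *m zB E l) (zA w l *m zB E l)
  + lam * \sum_l mxdot (zB E l) (zB E l))).
  apply: mulr_ge0 => //; apply: addr_ge0; last apply: (mulr_ge0 (ltW lam_gt0)).
    by apply: sumr_ge0 => l _; apply: mxdot_ge0.
  by apply: sumr_ge0 => l _; apply: mxdot_ge0.
move=> h; rewrite !objectiveE zC_fixed //.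
have eA : zA (w + h *: E) = zA w.
  by apply/functional_extensionality_dep => l; rewrite zA_line A0 scaler0 addr0.
have eR l : resid (w + h *: E) l = resid w l + qreal h *: (zA w l *m zB E l).
  by rewrite /resid zC_fixed // eA zB_line mulmxDr mulmx_qreal addrAC.
have e1 := sum_mxdot_line eR.
have e2 := sum_mxdot_line (zB_line w E h).
have e3 : \sum_l mxdot (gradB w l) (zB E l) =
    \sum_l mxdot (resid w l) (zA w l *m zB E l) + lam * \sum_l mxdot (zB w l) (zB E l).
  rewrite mulr_sumr -big_split; apply: eq_bigr => l _ /=.
  by rewrite mxdotDl mxdotZl; congr (_ + _); rewrite [RHS]mxdot_adjl.
rewrite eA [X in _ * (X + _) + _ = _]e1 [X in _ * (_ + _ * (_ + X)) + _ = _]e2.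
rewrite [X in _ = _ + _ * (_ * X) + _]e3.
rewrite (_ : n3%:R^-1 = 2 * (2 * n3%:R)^-1); last first.
  by rewrite invfM mulrA divff ?mul1r // pnatr_eq0.
by ring.
Qed.

End Objective.

(** * First-order conditions of the three updates *)

Section Steps.
Context {R : realType} {n1 n2 n3 : nat} {r : 'I_n3 -> nat}.
Variables (mu : quat R) (M : tensor (quat R) n1 n2 n3).
Variables (Om : {set 'I_n1 * 'I_n2 * 'I_n3}) (lam lam1 lam2 beta : R).
Hypotheses (mu_unit_pure : unit_pure mu) (n3_gt0 : (0 < n3)%N).
Hypotheses (lam_gt0 : 0 < lam) (lam1_gt0 : 0 < lam1) (lam2_gt0 : 0 < lam2).
Hypothesis (beta_gt0 : 0 < beta).
Implicit Types (u v w z E : zvec R n1 n2 r).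
Local Notation f := (objective mu lam lam1 lam2).

Lemma zC_sub u v l : zC (u - v) l = zC u l - zC v l.
Proof.
rewrite -scaleN1r zC_line; congr (_ + _); apply/matrixP => i j.
by rewrite !mxE; apply: quat_eq; rewrite !qcompE /=; ring.
Qed.

Lemma zA_sub u v l : zA (u - v) l = zA u l - zA v l.
Proof.
rewrite -scaleN1r zA_line; congr (_ + _); apply/matrixP => i j.
by rewrite !mxE; apply: quat_eq; rewrite !qcompE /=; ring.
Qed.

Lemma zB_sub u v l : zB (u - v) l = zB u l - zB v l.
Proof.
rewrite -scaleN1r zB_line; congr (_ + _); apply/matrixP => i j.
by rewrite !mxE; apply: quat_eq; rewrite !qcompE /=; ring.
Qed.

Lemma tprojP (T : nmodType) (X : tensor T n1 n2 n3) :
  tproj Om X = 0 <-> forall i j l, (i, j, l) \in Om -> X l i j = 0.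
Proof.
split=> [X0 i j l ijl|X0].
  have := congr1 (fun Y : tensor T n1 n2 n3 => Y l i j) X0.
  by rewrite !(ffunE, mxE) ijl.
apply/ffunP => l; apply/matrixP => i j; rewrite !(ffunE, mxE).
by case: ifP => // /X0.
Qed.

Lemma tproj_compl (T : nmodType) (X : tensor T n1 n2 n3) :
  tproj Om X = 0 -> tproj (~: Om) X = X.
Proof.
move/tprojP => X0; apply/ffunP => l; apply/matrixP => i j; rewrite !(ffunE, mxE).
by rewrite inE; case: (boolP (_ \in Om)) => //= /X0 ->.
Qed.

Lemma zC_real w : tmap (@qre R) (zC w) = 0.
Proof. by apply/ffunP => l; apply/matrixP => i j; rewrite ffunE mxE zCE ffunE mxE. Qed.

Lemma tensorBE (X Y : tensor (quat R) n1 n2 n3) l i j :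
  (X - Y) l i j = X l i j - Y l i j.
Proof. by rewrite 2!ffunE 2!mxE. Qed.

Lemma tmapE (S T : Type) (g : S -> T) (X : tensor S n1 n2 n3) l i j :
  tmap g X l i j = g (X l i j).
Proof. by rewrite ffunE mxE. Qed.

Lemma tinner_pure (X : tensor (quat R) n1 n2 n3) w :
  tinner (tmap (@qi R) X) (tmap (@qi R) (zC w))
  + tinner (tmap (@qj R) X) (tmap (@qj R) (zC w))
  + tinner (tmap (@qk R) X) (tmap (@qk R) (zC w)) = tdot X (zC w).
Proof.
rewrite /tinner -!big_split; apply: eq_bigr => l _ /=.
rewrite -!big_split; apply: eq_bigr => i _ /=.
rewrite -!big_split; apply: eq_bigr => j _ /=.
rewrite !tmapE /qdot (_ : qre (zC w l i j) = 0) ?mulr0 ?add0r //.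
by rewrite zCE.
Qed.

Lemma tdot_line (X : tensor (quat R) n1 n2 n3) w E h :
  tdot X (zC (w + h *: E)) = tdot X (zC w) + h * tdot X (zC E).
Proof.
rewrite /tdot mulr_sumr -big_split; apply: eq_bigr => l _ /=.
by rewrite zC_line mxdotDr mxdotZr.
Qed.

(** A quadratic function that is smallest at the origin has no linear term. *)
Lemma linear_coef_eq0 (a q : R) : (forall h, 0 <= h * a + h ^+ 2 * q) -> a = 0.
Proof.
move=> pos; have [s s0 sq] : exists2 s, 0 < s & q <= s.
  by exists (1 + `|q|); rewrite ?ltr_wpDr // (le_trans (ler_norm q)) // lerDr.
(* With s positive and at least q, this step makes the linear term win over the
   quadratic one. *)
have := pos (- (a / (2 * s))).
have -> : - (a / (2 * s)) * a + (- (a / (2 * s))) ^+ 2 * q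
    = (a / (2 * s)) ^+ 2 * (q - 2 * s).
  by field; rewrite gt_eqF.
move=> h; apply/eqP; move: h; apply: contraLR => a0.
rewrite -ltNge pmulr_rlt0; first by move: s0 sq; lra.
by rewrite exprn_even_gt0 //= mulf_neq0 // invr_eq0 mulf_neq0 // gt_eqF.
Qed.

(** The directions [E] are those that stay in the constraint set, so the
    minimality of the new [C] along each of them fixes the linear coefficient of
    [f]: it cancels the term that the error tensor adds to the subproblem. The
    factor 16 is the inverse square of the tolerance 1/4. *)
Lemma C_step_line z z' w : C_step mu M Om lam1 lam2 z z' -> feasible M Om z ->
  zC w = zC z' -> zA w = zA z -> zB w = zB z ->
  exists2 delta : tensor (quat R) n1 n2 n3,
    16 * tdot delta delta <= tdot (zC (z - z')) (zC (z - z')) &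
    forall E, tproj Om (zC E) = 0 -> (forall l, zA E l = 0) ->
      (forall l, zB E l = 0) ->
      exists2 q, 2^-1 * tdot (zC E) (zC E) <= q & forall h, f (w + h *: E) =
        f w + h * (- tdot delta (zC E)) + h ^+ 2 * q.
Proof.
move=> [delta [_ dOm dle [feas' min]]] feas wC wA wB; exists delta.
  rewrite (tproj_compl dOm) in dle.
  have -> : zC (z - z') = - (zC z' - zC z).
    by rewrite opprB; apply/ffunP => l; rewrite zC_sub !ffunE.
  have -> : tdot (- (zC z' - zC z)) (- (zC z' - zC z)) = tfro (zC z' - zC z) ^+ 2.
    rewrite tfro_sqr; apply: eq_bigr => l _; apply: eq_bigr => i _.
    apply: eq_bigr => j _; rewrite !(ffunE, mxE) /qdot !qcompE.
    by ring.
  rewrite -tfro_sqr.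
  have : tfro delta ^+ 2 <= (4^-1 * tfro (zC z' - zC z)) ^+ 2.
    by rewrite lerXn2r // nnegrE ?mulr_ge0 // sqrtr_ge0.
  by rewrite exprMn; lra.
move=> E EOm EA EB.
have [a aE] := objective_lineC mu lam lam1 lam2 w EA EB.
exists (2^-1 * tdot (zC E) (zC E) + TV lam1 lam2 (zC E)).
  by rewrite lerDl TV_ge0.
suff -> : - tdot delta (zC E) = a.
  by move=> h; rewrite aE scale0r addr0.
apply/eqP; rewrite eq_sym -subr_eq0 opprK; apply/eqP.
apply: (@linear_coef_eq0 _ (2^-1 * tdot (zC E) (zC E) + TV lam1 lam2 (zC E))) => h.
have feasE : C_constraint M Om (zC (w + h *: E)).
  split; first exact: zC_real.
  apply/tprojP => i j l ijl.
  have /tprojP/(_ i j l ijl) := EOm; case: feas' => _ /tprojP/(_ i j l ijl).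
  rewrite -wC !tensorBE zC_line => e1 e2.
  by rewrite [X in X - _]mxE [X in _ + X - _]mxE e2 mulr0 addr0.
have := min _ feasE.
have objE y : zA y = zA z -> zB y = zB z -> C_objective mu lam1 lam2 z delta (zC y)
   = f y - lam / (2 * n3%:R) *
     (\sum_l mxfro (zA z l) ^+ 2 + \sum_l mxfro (zB z l) ^+ 2) + tdot delta (zC y).
  move=> yA yB; rewrite /C_objective tinner_pure /objective yA yB.
  by ring.
rewrite -wC !objE //; last first.
- by apply/functional_extensionality_dep => l; rewrite -wB zB_line EB scaler0 addr0.
- by apply/functional_extensionality_dep => l; rewrite -wA zA_line EA scaler0 addr0.
rewrite tdot_line aE scale0r addr0; lra.
Qed.

Lemma mulmx_gram_shift m n p (A : 'M[quat R]_(m, n)) (B : 'M[quat R]_(n, p)) c :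
  A *m (B *m ctrmx B + (qreal c)%:M) = A *m B *m ctrmx B + qreal c *: A.
Proof. by rewrite mulmxDr mulmxA mul_mx_qreal. Qed.

Lemma zmod_shift (V : zmodType) (p a b c d : V) :
  c + d = p + (a + b) -> p - c + a = d - b.
Proof.
move=> e; have -> : d = p + (a + b) - c by rewrite -e addrC addKr.
by rewrite !addrA [RHS]addrAC addrK [RHS]addrAC.
Qed.

(** Multiplying the closed form of the update by the inverted matrix gives the
    normal equation of the proximal subproblem, in which [beta] weighs the
    displacement of the block. *)
Lemma A_step_grad z z' w : A_step mu lam beta z z' ->
  zC w = zC z' -> zA w = zA z' -> zB w = zB z ->
  forall l, gradA mu lam w l = qreal beta *: zA (z - z') l.
Proof.
move=> stepA wC wA wB l.
have /qinvmxP[_ inv] := gram_inj (X := zB z l) (addr_gt0 lam_gt0 beta_gt0).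
have := congr1 (fun X => X *m (zB z l *m ctrmx (zB z l) + (qreal (lam + beta))%:M))
  (stepA l).
rewrite -mulmxA inv mulmx1 mulmx_gram_shift => /esym e.
rewrite /gradA /resid wA wB wC zA_sub mulmxBl scalerBr.
move: e; rewrite qrealD scalerDl; exact: zmod_shift.
Qed.

Lemma B_step_grad z z' w : B_step mu lam beta z z' ->
  zC w = zC z' -> zA w = zA z' -> zB w = zB z' ->
  forall l, gradB mu lam w l = qreal beta *: zB (z - z') l.
Proof.
move=> stepB wC wA wB l.
have := gram_inj (X := ctrmx (zA z' l)) (addr_gt0 lam_gt0 beta_gt0).
rewrite ctrmxK => /qinvmxP[inv _].
have := congr1 (mulmx (ctrmx (zA z' l) *m zA z' l + (qreal (lam + beta))%:M))
  (stepB l).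
rewrite mulmxA inv mul1mx mulmxDl mul_scalar_mx => e.
rewrite /gradB /resid wA wB wC zB_sub mulmxBr scalerBr mulmxA.
move: e; rewrite qrealD scalerDl => /esym; exact: zmod_shift.
Qed.

End Steps.

(** * Decrease, block derivatives and coercivity *)

Section BlockDecrease.
Context {R : realType} {n1 n2 n3 : nat} {r : 'I_n3 -> nat}.
Variables (mu : quat R) (M : tensor (quat R) n1 n2 n3).
Variables (Om : {set 'I_n1 * 'I_n2 * 'I_n3}) (lam lam1 lam2 beta : R).
Hypotheses (mu_unit_pure : unit_pure mu) (n3_gt0 : (0 < n3)%N).
Hypotheses (lam_gt0 : 0 < lam) (lam1_gt0 : 0 < lam1) (lam2_gt0 : 0 < lam2).
Hypothesis (beta_gt0 : 0 < beta).
Implicit Types (u v w z E : zvec R n1 n2 r).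
Local Notation f := (objective mu lam lam1 lam2).

Lemma tdot_line_ge0 (X Y : tensor (quat R) n1 n2 n3) h :
  0 <= tdot X X + h * (2 * tdot X Y) + h ^+ 2 * tdot Y Y.
Proof.
rewrite -(@sum_mxdot_line _ _ _ _ h (fun l => X l + qreal h *: Y l)) //.
by apply: sumr_ge0 => l _; apply: mxdot_ge0.
Qed.

(** Strong convexity gives half of the squared displacement; by Young's
    inequality and the tolerance on the error tensor, the linear term costs at
    most one quarter of it. *)
Lemma C_decrease z z' w : C_step mu M Om lam1 lam2 z z' -> feasible M Om z ->
  zC w = zC z' -> zA w = zA z -> zB w = zB z ->
  4^-1 * tdot (zC (z - z')) (zC (z - z')) <= f z - f w.
Proof.
move=> step feas wC wA wB.
have [delta dle line] := C_step_line lam lam1_gt0 lam2_gt0 step feas wC wA wB.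
have eD : zC (z - w) = zC (z - z').
  by apply/ffunP => l; rewrite !zC_sub wC.
have OmE : tproj Om (zC (z - w)) = 0.
  have [delta' [_ _ _ [[_ /tprojP f'] _]]] := step.
  apply/tprojP => i j l ijl; have /tprojP/(_ i j l ijl) := feas.
  have := f' i j l ijl; rewrite eD zC_sub !tensorBE => /eqP.
  rewrite subr_eq0 => /eqP e1 /eqP; rewrite subr_eq0 => /eqP e2.
  by rewrite 2!mxE e1 e2 subrr.
have [l|l|q qle lineE] := line _ OmE.
- by rewrite zA_sub wA subrr.
- by rewrite zB_sub wB subrr.
have := lineE 1; rewrite scale1r addrC subrK => ->.
(* Young's inequality, as the nonnegativity of |D - 4 delta|^2. *)
have := tdot_line_ge0 (zC (z - z')) delta (-4).
have tdC : tdot (zC (z - z')) delta = tdot delta (zC (z - z')).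
  by apply: eq_bigr => l _; rewrite mxdotC.
by move: qle dle; rewrite tdC eD; lra.
Qed.

(** Convexity in the block: the linear term at the updated point, evaluated at
    the displacement, is [beta / n3] times its squared norm. *)
Lemma A_decrease z z' v w : A_step mu lam beta z z' ->
  zC v = zC z' -> zA v = zA z -> zB v = zB z ->
  zC w = zC z' -> zA w = zA z' -> zB w = zB z ->
  beta / n3%:R * \sum_l mxdot (zA (z - z') l) (zA (z - z') l) <= f v - f w.
Proof.
move=> step vC vA vB wC wA wB.
have eD l : zA (v - w) l = zA (z - z') l by rewrite !zA_sub vA wA.
have [l|l|q q0 lineE] := objective_lineA lam1 lam2 mu_unit_pure n3_gt0 lam_gt0 w (E := v - w).
- by rewrite zC_sub vC wC subrr.
- by rewrite zB_sub vB wB subrr.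
have dot : \sum_l mxdot (gradA mu lam w l) (zA (v - w) l) =
    beta * \sum_l mxdot (zA (z - z') l) (zA (z - z') l).
  rewrite mulr_sumr; apply: eq_bigr => l _.
  by rewrite (A_step_grad lam_gt0 beta_gt0 step wC wA wB) eD mxdotZl.
have := lineE 1; rewrite scale1r addrC subrK => ->.
rewrite [X in _ + 1 * (_ * X)]dot expr1n !mul1r.
by move: q0; lra.
Qed.

Lemma B_decrease z z' v w : B_step mu lam beta z z' ->
  zC v = zC z' -> zA v = zA z' -> zB v = zB z ->
  zC w = zC z' -> zA w = zA z' -> zB w = zB z' ->
  beta / n3%:R * \sum_l mxdot (zB (z - z') l) (zB (z - z') l) <= f v - f w.
Proof.
move=> step vC vA vB wC wA wB.
have eD l : zB (v - w) l = zB (z - z') l by rewrite !zB_sub vB wB.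
have [l|l|q q0 lineE] := objective_lineB lam1 lam2 mu_unit_pure n3_gt0 lam_gt0 w (E := v - w).
- by rewrite zC_sub vC wC subrr.
- by rewrite zA_sub vA wA subrr.
have dot : \sum_l mxdot (gradB mu lam w l) (zB (v - w) l) =
    beta * \sum_l mxdot (zB (z - z') l) (zB (z - z') l).
  rewrite mulr_sumr; apply: eq_bigr => l _.
  by rewrite (B_step_grad lam_gt0 beta_gt0 step wC wA wB) eD mxdotZl.
have := lineE 1; rewrite scale1r addrC subrK => ->.
rewrite [X in _ + 1 * (_ * X)]dot expr1n !mul1r.
by move: q0; lra.
Qed.

Definition zbasis (x : zidx n1 n2 r) : zvec R n1 n2 r := delta_mx 0 (enum_rank x).

Lemma zcoord_basis x y : zcoord (zbasis x) y = (y == x)%:R.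
Proof. by rewrite /zcoord mxE eqxx (inj_eq enum_rank_inj). Qed.

Lemma zC_eq0 E : (forall y, zcoord E (inl (inl y)) = 0) -> forall l, zC E l = 0.
Proof. by move=> e l; apply/matrixP => i j; rewrite zCE !e mxE. Qed.

Lemma zA_eq0 E : (forall y, zcoord E (inl (inr y)) = 0) -> forall l, zA E l = 0.
Proof. by move=> e l; apply/matrixP => i j; rewrite !mxE /= !e. Qed.

Lemma zB_eq0 E : (forall y, zcoord E (inr y) = 0) -> forall l, zB E l = 0.
Proof. by move=> e l; apply/matrixP => i j; rewrite !mxE /= !e. Qed.

Lemma norm_le_of_sqr (a b : R) : 0 <= b -> a ^+ 2 <= b ^+ 2 -> `|a| <= b.
Proof.
by move=> b0 h; rewrite -(ger0_norm b0) -(@ler_pXn2r _ 2) ?nnegrE // !real_normK ?num_real.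
Qed.

Lemma sum_basis (T : finType) (F : T -> R) (c : T -> R) x :
  (forall y, c y = (y == x)%:R) -> \sum_y F y * c y = F x.
Proof.
move=> cE; rewrite (bigD1 x) //= cE eqxx mulr1 big1 ?addr0 // => y /negPf yx.
by rewrite cE yx mulr0.
Qed.

(** Cauchy-Schwarz for the error tensor and a unit coordinate direction. *)
Lemma C_derive z z' w a i j l : C_step mu M Om lam1 lam2 z z' -> feasible M Om z ->
  zC w = zC z' -> zA w = zA z -> zB w = zB z -> (i, j, l) \notin Om ->
  `|'D_(zbasis (inl (inl (a, (i, j, l))))) f w| <= l2norm (z - z').
Proof.
move=> step feas wC wA wB ijl.
have [delta dle line] := C_step_line lam lam1_gt0 lam2_gt0 step feas wC wA wB.
set E := zbasis _.
have OmE : tproj Om (zC E) = 0.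
  apply/tprojP => i' j' l' ijl'; rewrite zCE !zcoord_basis.
  have ne b : (inl (inl (b, (i', j', l'))) == inl (inl (a, (i, j, l))) :> zidx n1 n2 r) = false.
    by apply/eqP => -[_ e1 e2 e3]; move: ijl; rewrite -e1 -e2 -e3 ijl'.
  by rewrite !ne.
have [l'|l'|q _ lineE] := line _ OmE.
- by apply: zA_eq0 => y; rewrite zcoord_basis.
- by apply: zB_eq0 => y; rewrite zcoord_basis.
rewrite (derive_quadratic lineE) normrN; apply: norm_le_of_sqr (l2norm_ge0 _) _.
have E1 : tdot (zC E) (zC E) = 1.
  rewrite tdot_zC (@sum_basis _ _ _ (a, (i, j, l))).
    by rewrite zcoord_basis eqxx.
  by move=> y; rewrite zcoord_basis.
(* Cauchy-Schwarz: delta minus its projection on the unit direction has a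
   nonnegative squared norm. *)
have := tdot_line_ge0 delta (zC E) (- tdot delta (zC E)).
rewrite E1 l2norm_blocks.
have : 0 <= tdot (zC (z - z')) (zC (z - z')).
  by apply: sumr_ge0 => k _; apply: mxdot_ge0.
have : 0 <= \sum_l mxdot (zA (z - z') l) (zA (z - z') l).
  by apply: sumr_ge0 => k _; apply: mxdot_ge0.
have : 0 <= \sum_l mxdot (zB (z - z') l) (zB (z - z') l).
  by apply: sumr_ge0 => k _; apply: mxdot_ge0.
by move: dle; rewrite expr2; nra.
Qed.

Lemma A_derive z z' w x : A_step mu lam beta z z' ->
  zC w = zC z' -> zA w = zA z' -> zB w = zB z ->
  `|'D_(zbasis (inl (inr x))) f w| <= beta / n3%:R * l2norm (z - z').
Proof.
move=> step wC wA wB; set E := zbasis _.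
have [l|l|q q0 lineE] := objective_lineA lam1 lam2 mu_unit_pure n3_gt0 lam_gt0 w (E := E).
- by apply: zC_eq0 => y; rewrite zcoord_basis.
- by apply: zB_eq0 => y; rewrite zcoord_basis.
rewrite (derive_quadratic lineE).
under eq_bigr do rewrite (A_step_grad lam_gt0 beta_gt0 step wC wA wB) mxdotZl.
rewrite -mulr_sumr sum_mxdot_zA (@sum_basis _ _ _ x); last first.
  by move=> y; rewrite zcoord_basis.
rewrite mulrA [_ / _]mulrC normrM ger0_norm ?mulr_ge0 ?(ltW beta_gt0) //.
by rewrite ler_wpM2l ?mulr_ge0 ?(ltW beta_gt0) // coord_le_l2norm.
Qed.

Lemma B_derive z z' w x : B_step mu lam beta z z' ->
  zC w = zC z' -> zA w = zA z' -> zB w = zB z' ->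
  `|'D_(zbasis (inr x)) f w| <= beta / n3%:R * l2norm (z - z').
Proof.
move=> step wC wA wB; set E := zbasis _.
have [l|l|q q0 lineE] := objective_lineB lam1 lam2 mu_unit_pure n3_gt0 lam_gt0 w (E := E).
- by apply: zC_eq0 => y; rewrite zcoord_basis.
- by apply: zA_eq0 => y; rewrite zcoord_basis.
rewrite (derive_quadratic lineE).
under eq_bigr do rewrite (B_step_grad lam_gt0 beta_gt0 step wC wA wB) mxdotZl.
rewrite -mulr_sumr sum_mxdot_zB (@sum_basis _ _ _ x); last first.
  by move=> y; rewrite zcoord_basis.
rewrite mulrA [_ / _]mulrC normrM ger0_norm ?mulr_ge0 ?(ltW beta_gt0) //.
by rewrite ler_wpM2l ?mulr_ge0 ?(ltW beta_gt0) // coord_le_l2norm.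
Qed.

Lemma norm_le_1D_of_sqr (a b : R) : a ^+ 2 <= b -> `|a| <= 1 + b.
Proof.
move=> ab; rewrite ler_norml; apply/andP; split.
  by have := sqr_ge0 (a + 1); have := sqr_ge0 a; move: ab; rewrite !expr2; lra.
by have := sqr_ge0 (a - 1); have := sqr_ge0 a; move: ab; rewrite !expr2; lra.
Qed.

Lemma sqr_le_sum (T : finType) (F : T -> R) x : F x ^+ 2 <= \sum_y F y * F y.
Proof.
rewrite (bigD1 x) //= -expr2 lerDl; apply: sumr_ge0 => y _.
by rewrite -expr2 sqr_ge0.
Qed.

Lemma objective_geAB z : lam / (2 * n3%:R) *
  (\sum_l mxdot (zA z l) (zA z l) + \sum_l mxdot (zB z l) (zB z l)) <= f z.
Proof.
rewrite objectiveE // [in leRHS]mulrDr mulrA [_ / _]mulrC.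
rewrite -addrA [leRHS]addrCA lerDl addr_ge0 ?TV_ge0 // mulr_ge0 //.
by apply: sumr_ge0 => l _; apply: mxdot_ge0.
Qed.

Lemma objective_geC z :
  2^-1 * tdot (qtprod mu (zA z) (zB z) - zC z) (qtprod mu (zA z) (zB z) - zC z) <= f z.
Proof.
rewrite /objective tfro_sqr -addrA lerDl addr_ge0 ?TV_ge0 // mulr_ge0 //.
  by rewrite divr_ge0 ?mulr_ge0 // ltW.
by rewrite addr_ge0 //; apply: sumr_ge0 => l _; apply: sqr_ge0.
Qed.

Lemma tdot_sub_bound (X Y : tensor (quat R) n1 n2 n3) :
  tdot Y Y <= 2 * tdot (X - Y) (X - Y) + 2 * tdot X X.
Proof.
rewrite /tdot !mulr_sumr -big_split; apply: ler_sum => l _ /=.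
rewrite !mulr_sumr -big_split; apply: ler_sum => i _ /=.
rewrite !mulr_sumr -big_split; apply: ler_sum => j _ /=.
rewrite tensorBE; case: (X l i j) (Y l i j) => [a b c d] [a' b' c' d'].
rewrite /qdot !qcompE /=.
(* The difference of the two sides is |2 X - Y|^2. *)
have := sqr_ge0 (2 * a - a'); have := sqr_ge0 (2 * b - b').
have := sqr_ge0 (2 * c - c'); have := sqr_ge0 (2 * d - d').
by rewrite !expr2; lra.
Qed.

(** A bound on the regularisation terms of [f] controls the factors. It also
    controls [A * B], because [f] at the same factors with [C = 0] is a
    polynomial in bounded coordinates, and then [C], whose distance to [A * B]
    is controlled by the data term. *)
Lemma objective_coercive F : exists B, forall z, f z <= F -> bounded_by B z.
Proof.
pose S := 2 * n3%:R / lam * F.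
have AB z : f z <= F -> \sum_l mxdot (zA z l) (zA z l) + \sum_l mxdot (zB z l) (zB z l) <= S.
  move=> fz; have := le_trans (objective_geAB z) fz.
  have n0 : 0 < n3%:R :> R by rewrite ltr0n.
  by rewrite -ler_pdivlMl ?divr_gt0 ?mulr_gt0 // invf_div.
have A0 z : 0 <= \sum_l mxdot (zA z l) (zA z l).
  by apply: sumr_ge0 => l _; apply: mxdot_ge0.
have B0 z : 0 <= \sum_l mxdot (zB z l) (zB z l).
  by apply: sumr_ge0 => l _; apply: mxdot_ge0.
have boundA z y : f z <= F -> `|zcoord z (inl (inr y))| <= 1 + S.
  move=> fz; apply: norm_le_1D_of_sqr; apply: le_trans (AB z fz).
  apply: le_trans (sqr_le_sum (fun y => zcoord z (inl (inr y))) y) _.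
  by rewrite -sum_mxdot_zA lerDl.
have boundB z y : f z <= F -> `|zcoord z (inr y)| <= 1 + S.
  move=> fz; apply: norm_le_1D_of_sqr; apply: le_trans (AB z fz).
  apply: le_trans (sqr_le_sum (fun y => zcoord z (inr y)) y) _.
  by rewrite -sum_mxdot_zB lerDr.
have S0 z : f z <= F -> 0 <= 1 + S.
  by move=> fz; apply: addr_ge0 => //; apply: le_trans (AB z fz); rewrite addr_ge0.
have pf : polyfun (f : zvec R n1 n2 r -> R) by apply: poly_objective.
have [K [K0 Kf _]] := polyfun_locally_lipschitz pf (1 + S).
exists (1 + Num.max S (4 * F + 4 * K)) => z fz k.
rewrite -[z 0 k]/(z 0 k) -(enum_valK k) -/(zcoord z (enum_val k)).
have Sle : 1 + S <= 1 + Num.max S (4 * F + 4 * K) by rewrite lerD2l le_max lexx.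
case: (enum_val k) => [[y|y]|y].
- pose isC (x : zidx n1 n2 r) := if x is inl (inl _) then true else false.
  (* The same factors with C = 0: all coordinates of this point are already
     bounded. *)
  pose z0 := zsplice isC z 0.
  have zA0 : zA z0 = zA z by apply: eq_zA => ?; rewrite zcoord_splice.
  have zB0 : zB z0 = zB z by apply: eq_zB => ?; rewrite zcoord_splice.
  have zC0 : zC z0 = 0.
    apply/ffunP => l; rewrite [RHS]ffunE; apply: zC_eq0 => x.
    by rewrite zcoord_splice /zcoord mxE.
  have fz0 : f z0 <= K.
    apply: le_trans (ler_norm _) (Kf _ _) => k'.
    rewrite -(enum_valK k') -/(zcoord z0 (enum_val k')) zcoord_splice.
    case: (enum_val k') => [[x|x]|x] /=; [|exact: boundA|exact: boundB].
    by rewrite /zcoord mxE normr0 (S0 z).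
  apply: norm_le_1D_of_sqr; rewrite le_max; apply/orP; right.
  apply: le_trans (sqr_le_sum (fun y => zcoord z (inl (inl y))) y) _.
  rewrite -tdot_zC; apply: le_trans (tdot_sub_bound (qtprod mu (zA z) (zB z)) _) _.
  have := objective_geC z0; rewrite zA0 zB0 zC0 subr0.
  by have := objective_geC z; move: fz fz0; lra.
- by apply: le_trans Sle; apply: boundA.
- by apply: le_trans Sle; apply: boundB.
Qed.

End BlockDecrease.

(** * The QRTC sequence *)

Definition free_coord n1 n2 n3 (r : 'I_n3 -> nat) (Om : {set 'I_n1 * 'I_n2 * 'I_n3})
    (x : zidx n1 n2 r) : bool :=
  if x is inl (inl (_, (i, j, l))) then (i, j, l) \notin Om else true.

Lemma proj_gradE (R : realType) n1 n2 n3 (r : 'I_n3 -> nat)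
    (Om : {set 'I_n1 * 'I_n2 * 'I_n3}) (g : zvec R n1 n2 r) k :
  proj_grad Om g 0 k = if free_coord Om (enum_val k) then g 0 k else 0.
Proof.
have gk : g 0 k = zcoord g (enum_val k) by rewrite /zcoord enum_valK.
rewrite mxE !gk; case: (enum_val k) => [[[a [[i j] l]]|x]|x] //=.
by rewrite !(ffunE, mxE) inE.
Qed.

Section Sequence.
Context {R : realType} {n1 n2 n3 : nat} {r : 'I_n3 -> nat}.
Variables (mu : quat R) (M : tensor (quat R) n1 n2 n3).
Variables (Om : {set 'I_n1 * 'I_n2 * 'I_n3}) (lam lam1 lam2 beta : R).
Hypotheses (mu_unit_pure : unit_pure mu) (n3_gt0 : (0 < n3)%N).
Hypotheses (lam_gt0 : 0 < lam) (lam1_gt0 : 0 < lam1) (lam2_gt0 : 0 < lam2).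
Hypothesis (beta_gt0 : 0 < beta).
Variable z : nat -> zvec R n1 n2 r.
Hypothesis z_QRTC : QRTC_sequence mu M Om lam lam1 lam2 beta z.
Local Notation f := (objective mu lam lam1 lam2).

Lemma QRTC_feasible t : feasible M Om (z t).
Proof.
case: t => [|t]; first by case: z_QRTC.
by have [_ /(_ t)[[delta [_ _ _ [[_ h] _]]] _ _]] := z_QRTC.
Qed.

Definition in_C (x : zidx n1 n2 r) := if x is inl (inl _) then true else false.
Definition in_CA (x : zidx n1 n2 r) := if x is inl _ then true else false.

(** The point [(C^(t+1), A^t, B^t)]. *)
Definition after_C t := zsplice in_C (z t) (z t.+1).
(** The point [(C^(t+1), A^(t+1), B^t)]. *)
Definition after_A t := zsplice in_CA (z t) (z t.+1).

Lemma after_CE t : [/\ zC (after_C t) = zC (z t.+1), zA (after_C t) = zA (z t) &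
  zB (after_C t) = zB (z t)].
Proof.
split; [apply: eq_zC|apply: eq_zA|apply: eq_zB] => y; by rewrite zcoord_splice.
Qed.

Lemma after_AE t : [/\ zC (after_A t) = zC (z t.+1), zA (after_A t) = zA (z t.+1) &
  zB (after_A t) = zB (z t)].
Proof.
split; [apply: eq_zC|apply: eq_zA|apply: eq_zB] => y; by rewrite zcoord_splice.
Qed.

Lemma QRTC_decrease t :
  Num.min 4^-1 (beta / n3%:R) * l2norm (z t - z t.+1) ^+ 2 <= f (z t) - f (z t.+1).
Proof.
have [_ /(_ t)[stepC stepA stepB]] := z_QRTC.
have [C1 A1 B1] := after_CE t; have [C2 A2 B2] := after_AE t.
have dC := C_decrease lam lam1_gt0 lam2_gt0 stepC (QRTC_feasible t) C1 A1 B1.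
have dA := A_decrease lam1 lam2 mu_unit_pure n3_gt0 lam_gt0 beta_gt0 stepA
  C1 A1 B1 C2 A2 B2.
have dB := B_decrease lam1 lam2 mu_unit_pure n3_gt0 lam_gt0 beta_gt0 stepB
  C2 A2 B2 erefl erefl erefl.
rewrite l2norm_blocks !mulrDr.
have le1 : Num.min 4^-1 (beta / n3%:R) <= 4^-1 by rewrite ge_min lexx.
have le2 : Num.min 4^-1 (beta / n3%:R) <= beta / n3%:R by rewrite ge_min lexx orbT.
have tele (a b c d : R) : a - d = (a - b) + (b - c) + (c - d) by ring.
rewrite [leRHS](tele _ (f (after_C t)) (f (after_A t))).
apply: lerD; first apply: lerD.
- apply: le_trans dC; apply: ler_wpM2r le1.
  by apply: sumr_ge0 => l _; apply: mxdot_ge0.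
- apply: le_trans dA; apply: ler_wpM2r le2.
  by apply: sumr_ge0 => l _; apply: mxdot_ge0.
- apply: le_trans dB; apply: ler_wpM2r le2.
  by apply: sumr_ge0 => l _; apply: mxdot_ge0.
Qed.

Lemma decrease_rate_gt0 : 0 < Num.min 4^-1 (beta / n3%:R).
Proof. by rewrite lt_min invr_gt0 ltr0n divr_gt0 ?ltr0n. Qed.

Lemma QRTC_bounded : exists B, forall t, bounded_by B (z t).
Proof.
have [B coer] := objective_coercive (r := r) (n1 := n1) (n2 := n2)
  mu_unit_pure n3_gt0 lam_gt0 lam1_gt0 lam2_gt0 (f (z 0%N)).
exists B => t; apply: coer; elim: t => [|t ih]; first exact: lexx.
apply: le_trans ih; rewrite -subr_ge0; apply: le_trans (QRTC_decrease t).
by rewrite mulr_ge0 ?sqr_ge0 // ltW // decrease_rate_gt0.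
Qed.

Lemma QRTC_near_critical (k : 'I_#|zidx n1 n2 r|) : free_coord Om (enum_val k) ->
  exists L, forall t, exists w : zvec R n1 n2 r,
    (forall j, w 0 j = z t 0 j \/ w 0 j = z t.+1 0 j) /\
    `|'D_(delta_mx 0 k) f w| <= L * l2norm (z t - z t.+1).
Proof.
have mix S t j : zsplice S (z t) (z t.+1) 0 j = z t 0 j \/
    zsplice S (z t) (z t.+1) 0 j = z t.+1 0 j.
  by rewrite mxE; case: ifP => _; [right|left].
rewrite -{2}(enum_valK k); case: (enum_val k) => [[[a [[i j] l]]|x]|x] /= fk.
(* Each coordinate is examined at the point reached by the update of its own
   block. *)
- exists 1 => t; exists (after_C t); split; first exact: mix.
  have [_ /(_ t)[stepC _ _]] := z_QRTC; have [C1 A1 B1] := after_CE t.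
  rewrite mul1r.
  exact: (C_derive lam lam1_gt0 lam2_gt0 a stepC (QRTC_feasible t) C1 A1 B1 fk).
- exists (beta / n3%:R) => t; exists (after_A t); split; first exact: mix.
  have [_ /(_ t)[_ stepA _]] := z_QRTC; have [C2 A2 B2] := after_AE t.
  exact: (A_derive lam1 lam2 mu_unit_pure n3_gt0 lam_gt0 beta_gt0 x stepA C2 A2 B2).
- exists (beta / n3%:R) => t; exists (z t.+1); split; first by right.
  have [_ /(_ t)[_ _ stepB]] := z_QRTC.
  exact: (B_derive lam1 lam2 mu_unit_pure n3_gt0 lam_gt0 beta_gt0 x stepB
    erefl erefl erefl).
Qed.

(** The constrained coordinates are constant along the sequence. *)
Lemma cluster_feasible zs : cluster (z @ \oo) zs -> feasible M Om zs.
Proof.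
move=> czs; apply/tprojP => i j l ijl.
have fixt t : zC (z t) l i j = zC (z 0%N) l i j.
  have /tprojP/(_ _ _ _ ijl) := QRTC_feasible t.
  have /tprojP/(_ _ _ _ ijl) := QRTC_feasible 0.
  rewrite !tensorBE => /eqP; rewrite subr_eq0 => /eqP -> /eqP.
  by rewrite subr_eq0 => /eqP.
have /tprojP/(_ _ _ _ ijl) := QRTC_feasible 0; rewrite !tensorBE => <-.
congr (_ - _).
have lim x : (forall t, zcoord (z t) x = zcoord (z 0%N) x) ->
    zcoord zs x = zcoord (z 0%N) x.
  move=> cx; apply: (cluster_limit (F := fun v => zcoord v x) _ czs).
    exact/polyfun_continuous/poly_zcoord.
  by under eq_fun do rewrite cx; exact: cvg_cst.
rewrite !zCE; congr Quat; apply: lim => t.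
- by have := congr1 (@qi R) (fixt t); rewrite !zCE.
- by have := congr1 (@qj R) (fixt t); rewrite !zCE.
- by have := congr1 (@qk R) (fixt t); rewrite !zCE.
Qed.

End Sequence.

(** * Error bound and stationarity of accumulation points *)

Theorem theorem4p3 (R : realType) (n1 n2 n3 : nat)
    (n1_gt0 : (0 < n1)%N) (n2_gt0 : (0 < n2)%N) (n3_gt0 : (0 < n3)%N)
    (r : 'I_n3 -> nat) (r_gt0 : forall l, (0 < r l)%N)
    (mu : quat R) (mu_unit_pure : unit_pure mu)
    (M : tensor (quat R) n1 n2 n3) (M_pure : tmap (@qre R) M = 0)
    (Om : {set 'I_n1 * 'I_n2 * 'I_n3})
    (lam lam1 lam2 beta : R)
    (lam_gt0 : 0 < lam) (lam1_gt0 : 0 < lam1) (lam2_gt0 : 0 < lam2)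
    (beta_gt0 : 0 < beta)
    (z : nat -> zvec R n1 n2 r)
    (z_QRTC : QRTC_sequence mu M Om lam lam1 lam2 beta z) :
  (exists K2 : R, forall t : nat,
     l2norm (proj_grad Om (gradient (objective mu lam lam1 lam2) (z t)))
       <= K2 * l2norm (z t - z t.+1))
  /\ (forall zs : zvec R n1 n2 r, cluster (z @ \oo) zs ->
        stationary mu M Om lam lam1 lam2 zs).
Proof.
have [B bz] := QRTC_bounded mu_unit_pure n3_gt0 lam_gt0 lam1_gt0 lam2_gt0
  beta_gt0 z_QRTC.
have crit := descent_criterion (poly_objective (r := r) lam lam1 lam2 mu_unit_pure n3_gt0)
  (objective_ge0 mu_unit_pure n3_gt0 lam_gt0 lam1_gt0 lam2_gt0) bz
  (decrease_rate_gt0 n3_gt0 beta_gt0)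
  (QRTC_decrease mu_unit_pure n3_gt0 lam_gt0 lam1_gt0 lam2_gt0 beta_gt0 z_QRTC)
  (QRTC_near_critical mu_unit_pure n3_gt0 lam_gt0 lam1_gt0 lam2_gt0 beta_gt0 z_QRTC).
split.
  apply: l2norm_bigO => k; case: (boolP (free_coord Om (enum_val k))) => fk.
    have [[K bK] _] := crit k fk; exists K => t.
    by rewrite proj_gradE fk mxE; exact: bK.
  by exists 0 => t; rewrite proj_gradE (negPf fk) normr0 mul0r.
move=> zs czs; split; first exact: (cluster_feasible z_QRTC czs).
apply/rowP => k; rewrite proj_gradE [RHS]mxE; case: ifP => // fk.
by have [_ /(_ zs czs) <-] := crit k fk; rewrite mxE.
Qed.
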